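(* Let $q=p^h>7$ be odd (a power of an odd prime $p$), let $m=(q+1)/2$, and suppose that $i=(m-2)/2$ is an integer satisfying $\gcd(i,m)=\gcd(i+2,m)=1$. Let $k=\overline{\mathbf{F}}_{q^2}=\overline{\mathbf{F}}_q$ and let $K_i=k(x,y)$ be the function field over $k$ defined by $y^m=x^i(x^2+1)$. If $H$ is the subgroup of $\operatorname{Aut}_k(K_i)$ constructed by Beelen, Montanucci, Niemann and Quoos (in Theorem 4.6 of their paper on the maximal function fields $\mathbf{F}_{q^2}(x,y)$, $y^m=x^i(x^2+1)$), then $\operatorname{Aut}_k(K_i)=H$. In particular, $|\operatorname{Aut}_k(K_i)|=4(q+1)$.
   Context: $\operatorname{Aut}_k(K_i)$ denotes the group of field automorphisms of $K_i$ that fix $k$ elementwise. The field $K_i=k\mathcal{F}_i$ is the extension of constants to $k$ of the $\mathbf{F}_{q^2}$-maximal function field $\mathcal{F}_i=\mathbf{F}_{q^2}(x,y)$ defined by $y^m=x^i(x^2+1)$; the corresponding smooth projective curve has genus $m-1$. The group $H$ is the specific subgroup of $\operatorname{Aut}_k(K_i)$ that Beelen, Montanucci, Niemann and Quoos constructed for the exceptional parameter $i=(m-2)/2$ with $q>7$; it has order $4(q+1)$, and they conjectured that $|\operatorname{Aut}_k(K_i)|=4(q+1)$. *)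

(* Defs.v *)
From HB Require Import structures.
From mathcomp Require Import all_boot all_order all_algebra.
From mathcomp Require Import boolp classical_sets functions cardinality.

Set Implicit Arguments.
Unset Strict Implicit.
Unset Printing Implicit Defensive.

Import GRing.Theory.
Local Open Scope ring_scope.
Local Open Scope classical_set_scope.

Definition is_algebraic_closure (F : fieldType) (k : closedFieldType)
    (iota : {rmorphism F -> k}) : Prop :=
  forall a : k, algebraicOver iota a.

Section FunctionField.
Variables (k K : fieldType) (kappa : {rmorphism k -> K}).

(* K = k(x, y) with x transcendental over k and y ^ m = x ^ i (x ^ 2 + 1).
   These conditions determine K up to isomorphism as soon as
   T ^ m - x ^ i (x ^ 2 + 1) is irreducible over k(x); this holds whenever the
   characteristic is not 2 and -1 is a square in k (Eisenstein at a root of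
   x ^ 2 + 1). *)
Record is_function_field (m i : nat) (x y : K) : Prop := IsFunctionField {
  x_transcendental : ~ algebraicOver kappa x;
  curve_equation : y ^+ m = x ^+ i * (x ^+ 2 + 1);
  generated_by_xy : forall z : K, exists P Q : {poly {poly k}},
    let ev (R : {poly {poly k}}) := (map_poly (map_poly kappa) R).[x, y] in
    ev Q != 0 /\ z = ev P / ev Q
}.

Definition fieldAut : set (K -> K) :=
  [set f | [/\ zmod_morphism f, monoid_morphism f, bijective f
             & forall c : k, f (kappa c) = kappa c]].

Definition comp_subgroup (G : set (K -> K)) : Prop :=
  [/\ G idfun,
      forall f g, G f -> G g -> G (f \o g)
    & forall f g, G f -> cancel f g -> cancel g f -> G g].

Definition generated_subgroup (S : set (K -> K)) : set (K -> K) :=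
  smallest comp_subgroup S.

Section BMNQ.
Variables (m i : nat) (x y : K).

(* (x, y) |-> (a ^ m x, a y) with a ^ (2 m) = 1, so a ^ m = 1 or a ^ m = -1;
   it preserves the curve when i is odd. *)
Definition gen_scale (f : K -> K) : Prop :=
  exists a : k, [/\ a ^+ (2 * m) = 1,
    f x = kappa (a ^+ m) * x & f y = kappa a * y].

(* (x, y) |-> (1 / x, y / x); it preserves the curve when m = 2 i + 2. *)
Definition gen_inv (f : K -> K) : Prop := f x = x^-1 /\ f y = y / x.

(* Lift of the Moebius map x |-> (x + I) / (I x + 1), I ^ 2 = -1, which
   permutes cyclically the branch points 0 -> I -> oo -> - I -> 0 of the
   degree m map x.  For m = 2 i + 2 and i odd,
     fx ^ i (fx ^ 2 + 1) = 4 I ^ - (i + 1) x (x ^ 2 + 1) ^ i / (x - I) ^ m,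
   and x (x ^ 2 + 1) ^ i = (y ^ i / x ^ ((i - 1) / 2)) ^ m
   because i ^ 2 - 1 = m (i - 1) / 2; hence the condition on c. *)
Definition gen_rot (f : K -> K) : Prop :=
  exists I c : k, [/\ I ^+ 2 = -1, c ^+ m * I ^+ i.+1 = 4,
    f x = (x + kappa I) / (kappa I * x + 1)
  & f y = kappa c * y ^+ i / (x ^+ (i.-1)./2 * (x - kappa I))].

(* For i = (m - 2) / 2 this group has order 8 m: it maps onto the dihedral
   group of order 8 of Moebius maps preserving {0, oo, I, - I}, with kernel the
   group of order m of the maps (x, y) |-> (x, a y), a ^ m = 1. *)
Definition H_BMNQ : set (K -> K) :=
  generated_subgroup
    [set f | fieldAut f /\ [\/ gen_scale f, gen_inv f | gen_rot f]].

End BMNQ.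

End FunctionField.

(* Main.v *)
Require Import Defs.
From HB Require Import structures.
From mathcomp Require Import all_boot all_order all_algebra.
From mathcomp Require Import boolp classical_sets functions cardinality.
From mathcomp Require Import separable.
From mathcomp Require Import ring zify.

Set Implicit Arguments.
Unset Strict Implicit.
Unset Printing Implicit Defensive.

Import GRing.Theory.
Local Open Scope ring_scope.

(** The curve is a biquadratic cover of a projective line, and that cover is unique.

    Write [m = 2 n], so that [n = i + 1] is even. With [w = y ^ 2 / x],
    [s = y + y / x] and [t = y - y / x] one finds [w ^ n = x + 1 / x],
    [s ^ 2 = w (w ^ n + 2)] and [t ^ 2 = w (w ^ n - 2)]. Thus [K] is a Galois extension
    of [k(w)] whose group [V] is the Klein four-group; [s], [t] and [v = s t / w] with
    [v ^ 2 = w ^ (2 n) - 4] span its nontrivial eigenspaces, and [w ^ j dw / s],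
    [w ^ j dw / t], [w ^ j dw / v] are holomorphic for small [j].

    Let [z], [S], [T], [U] be the images of [w], [s], [t], [v] under an automorphism
    [sg]. The forms [z ^ j dz / S], [z ^ j dz / T], [z ^ j dz / U] are again
    holomorphic. Their traces to the [w]-line are holomorphic on a projective line,
    hence zero ([trace_form_zero]). So the sums of their conjugates under [V] vanish;
    by a Vandermonde argument [z] cannot have four, nor two, conjugates
    ([automorphism_preserves_rational]). Hence [sg] preserves [k(w)]. This is the
    Castelnuovo-Severi inequality for two maps of degree [4], made explicit; it
    uses that [n] is at least [5].

    Holomorphy is treated without places. Over finite [w] it is membership in the
    inverse different of the ring of integers over [k[w]], which contains [D b] for
    every integral [b] and the derivation [D = d / dw]. For [z ^ j dz / S] this
    membership is checked where [z] is integral and where [1 / z] is integral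
    ([codifferent_away_form]), and Kronecker's lemma shows that these two charts
    suffice ([codifferent_cover]).

    Since [sg] and its inverse preserve [k(w)], [sg w] is a Moebius transform of [w],
    and it permutes the branch points [0], [oo] and the roots of [w ^ (2 n) = 4]:
    [sg w] is [c w] with [c ^ m = 1], or [c / w] ([automorphism_w]). The rotation
    inverts [w] up to a constant, so up to composing with it the first case holds.
    Then [sg x] is a root of [X + 1 / X = c ^ n (x + 1 / x)] with [c ^ n = 1] or [-1],
    and [sg] is a scaling, possibly composed with the inversion
    ([automorphism_fixing_w]). These normal forms are pairwise distinct, and there
    are [2 * 2 m * 2 = 4 (q + 1)] of them. *)

(** * Subfields and quadratic extensions *)

Section Subfields.
Variable K : fieldType.

(** Subfields are predicates rather than types: the tower of quadratic extensions
    below then lives inside one ambient field, without coercions. *)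
Record is_subfield (E : K -> Prop) : Prop := IsSubfield {
  sub1 : E 1;
  subB : forall a b, E a -> E b -> E (a - b);
  subM : forall a b, E a -> E b -> E (a * b);
  subV : forall a, E a -> E a^-1 }.

Definition hom_on (E : K -> Prop) (f : K -> K) : Prop :=
  [/\ f 1 = 1, forall a b, E a -> E b -> f (a - b) = f a - f b
    & forall a b, E a -> E b -> f (a * b) = f a * f b].

Definition derivation_on (E : K -> Prop) (D : K -> K) : Prop :=
  (forall a b, E a -> E b -> D (a - b) = D a - D b) /\
  (forall a b, E a -> E b -> D (a * b) = D a * b + a * D b).

Lemma sub0 E : is_subfield E -> E 0.
Proof. by move=> EF; rewrite -(subrr 1); apply: subB => //; apply: sub1. Qed.

Lemma subN E a : is_subfield E -> E a -> E (- a).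
Proof. by move=> EF Ea; rewrite -sub0r; apply: subB => //; apply: sub0. Qed.

Lemma subD E a b : is_subfield E -> E a -> E b -> E (a + b).
Proof. by move=> EF Ea Eb; rewrite -[b]opprK; apply: subB => //; apply: subN. Qed.

Lemma subX E a n : is_subfield E -> E a -> E (a ^+ n).
Proof.
move=> EF Ea; elim: n => [|n IHn]; first exact: sub1.
by rewrite exprS; apply: subM.
Qed.

Lemma hom_onD E f a b : is_subfield E -> hom_on E f ->
  E a -> E b -> f (a + b) = f a + f b.
Proof.
move=> EF [f1 fB fM] Ea Eb.
have f0: f 0 = 0 by rewrite -(subrr 1) fB ?subrr //; apply: sub1.
have fN: f (- b) = - f b.
  by rewrite -sub0r fB ?f0 ?sub0r //; apply: sub0.
by rewrite -[b]opprK fB ?fN ?opprK //; apply: subN.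
Qed.

Lemma derivation_onD E D a b : is_subfield E -> derivation_on E D ->
  E a -> E b -> D (a + b) = D a + D b.
Proof.
move=> EF [DB DM] Ea Eb.
have D0: D 0 = 0 by rewrite -(subrr 1) DB ?subrr //; apply: sub1.
have DN: D (- b) = - D b.
  by rewrite -sub0r DB ?D0 ?sub0r //; apply: sub0.
by rewrite -[b]opprK DB ?DN ?opprK //; apply: subN.
Qed.

End Subfields.

Ltac insub EF := repeat first [ assumption | apply: (sub0 EF) | apply: (sub1 EF)
  | apply: (subM EF) | apply: (subB EF) | apply: (subD EF) | apply: (subN EF)
  | apply: (subV EF) | apply: (subX _ EF) ].

Section QuadraticExtension.
Variable K : fieldType.
Variables (E : K -> Prop) (s : K).
Hypotheses (EF : is_subfield E) (Es2 : E (s ^+ 2)) (Es : ~ E s).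

Definition adjoin (z : K) : Prop := exists a b, [/\ E a, E b & z = a + b * s].

Lemma adjoin_free a b a' b' : E a -> E b -> E a' -> E b' ->
  a + b * s = a' + b' * s -> a = a' /\ b = b'.
Proof.
move=> Ea Eb Ea' Eb' eq_ab.
have [eq_b | neq_b] := eqVneq b b'.
  by split=> //; move: eq_ab; rewrite eq_b => /addIr.
case: Es; have -> : s = (a' - a) / (b - b').
  apply: (mulIf (x := b - b')); first by rewrite subr_eq0.
  rewrite divfK ?subr_eq0 // mulrBr ![s * _]mulrC.
  by apply/eqP; rewrite subr_eq addrAC -eq_ab addrAC subrr add0r.
by apply: (subM EF); [apply: (subB EF)|apply/(subV EF)/(subB EF)].
Qed.

Lemma adjoin_sub a : E a -> adjoin a.
Proof. by move=> Ea; exists a, 0; rewrite mul0r addr0; split=> //; apply: sub0. Qed.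

Lemma adjoin_gen : adjoin s.
Proof. by exists 0, 1; rewrite mul1r add0r; split=> //; [apply: sub0|apply: sub1]. Qed.

Lemma adjoin_subfield : is_subfield adjoin.
Proof.
split; first exact: adjoin_sub (sub1 EF).
- move=> _ _ [a [b [Ea Eb ->]]] [c [d [Ec Ed ->]]].
  by exists (a - c), (b - d); split; [by insub EF..|ring].
- move=> _ _ [a [b [Ea Eb ->]]] [c [d [Ec Ed ->]]].
  exists (a * c + b * d * s ^+ 2), (a * d + b * c).
  by split; [insub EF..|ring].
- move=> _ [a [b [Ea Eb ->]]].
  have [z0 | nz] := eqVneq (a + b * s) 0.
    by rewrite z0 invr0; exact: adjoin_sub (sub0 EF).
  have nz' : a - b * s != 0.
    apply: contraNneq nz => eq0.
    have /(_ _)[] := @adjoin_free a (- b) 0 0 _ _ _ _; rewrite ?mulNr //.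
    + exact: subN.
    + exact: sub0.
    + exact: sub0.
    + by rewrite eq0 mul0r addr0.
    by move=> -> /eqP; rewrite oppr_eq0 => /eqP->; rewrite mul0r addr0.
  pose d := a ^+ 2 - b ^+ 2 * s ^+ 2.
  have dE : d = (a + b * s) * (a - b * s) by rewrite /d; ring.
  have nzd : d != 0 by rewrite dE mulf_neq0.
  have Ed : E d by rewrite /d; insub EF.
  exists (a / d), (- b / d); split.
  + by insub EF.
  + by insub EF.
  + have -> : a / d + - b / d * s = (a - b * s) / d by ring.
    by rewrite dE invfM mulrCA divff ?mulr1.
Qed.

Lemma adjoin_coords : exists c0 c1 : K -> K, forall a b, E a -> E b ->
  c0 (a + b * s) = a /\ c1 (a + b * s) = b.
Proof.
have ex z : exists ab : K * K,
    adjoin z -> [/\ E ab.1, E ab.2 & z = ab.1 + ab.2 * s].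
  have [[a [b ab]]|] := pselect (adjoin z); first by exists (a, b).
  by exists (0, 0).
have [c cP] := choice ex.
exists (fst \o c), (snd \o c) => a b Ea Eb /=.
have [|Ea' Eb' eq_ab] := cP (a + b * s); first by exists a, b.
by have [] := adjoin_free Ea Eb Ea' Eb' eq_ab.
Qed.

(** Coordinates in the basis [1], [s] are unique, so the image of [s] may be
    prescribed freely among the square roots of the image of [s ^+ 2]. *)
Lemma adjoin_hom f S : hom_on E f -> S ^+ 2 = f (s ^+ 2) ->
  exists g, [/\ hom_on adjoin g, forall a, E a -> g a = f a & g s = S].
Proof.
move=> fh S2; have [f1 fB fM] := fh.
have [c0 [c1 cP]] := adjoin_coords.
pose g z := f (c0 z) + f (c1 z) * S.
have gE a b : E a -> E b -> g (a + b * s) = f a + f b * S.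
  by move=> Ea Eb; rewrite /g; have [-> ->] := cP a b Ea Eb.
have E0 := sub0 EF; have E1 := sub1 EF.
have f0: f 0 = 0 by rewrite -(subrr 1) fB ?subrr.
have gE0 a : E a -> g a = f a.
  by move=> Ea; have := gE a 0 Ea E0; rewrite !(mul0r, addr0, f0).
exists g; split=> //; last first.
  by have := gE 0 1 E0 E1; rewrite !(mul1r, add0r, f0, f1).
split; first by rewrite gE0.
- move=> _ _ [a [b [Ea Eb ->]]] [c [d [Ec Ed ->]]].
  have -> : a + b * s - (c + d * s) = (a - c) + (b - d) * s by ring.
  by rewrite !gE //; [rewrite !fB //; ring | insub EF..].
- move=> _ _ [a [b [Ea Eb ->]]] [c [d [Ec Ed ->]]].
  have -> : (a + b * s) * (c + d * s) =
    (a * c + b * d * s ^+ 2) + (a * d + b * c) * s by ring.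
  rewrite !gE //; do ?by insub EF.
  move: (s ^+ 2) Es2 S2 => u Eu S2.
  rewrite !(hom_onD EF fh) ?[f (_ * _ * u)]fM ?fM //; do ?by insub EF.
  by rewrite -S2; ring.
Qed.

(** Differentiating [s ^+ 2] forces the value at [s]; uniqueness of coordinates
    makes it consistent. *)
Lemma adjoin_derivation D : derivation_on E D -> s != 0 -> 2 != 0 :> K ->
  exists D', [/\ derivation_on adjoin D', forall a, E a -> D' a = D a
               & D' s = D (s ^+ 2) / (2 * s)].
Proof.
move=> Dd nz_s nz_2; have [DB DM] := Dd.
have [c0 [c1 cP]] := adjoin_coords.
pose d := D (s ^+ 2) / (2 * s).
have dE : D (s ^+ 2) = 2 * s * d by rewrite /d mulrC divfK // mulf_neq0.
pose g z := D (c0 z) + D (c1 z) * s + c1 z * d.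
have gE a b : E a -> E b -> g (a + b * s) = D a + D b * s + b * d.
  by move=> Ea Eb; rewrite /g; have [-> ->] := cP a b Ea Eb.
have E0 := sub0 EF; have E1 := sub1 EF.
have D0: D 0 = 0 by rewrite -(subrr 1) DB ?subrr.
have D1: D 1 = 0.
  by have /eqP := DM 1 1 E1 E1; rewrite !(mul1r, mulr1) -subr_eq0 opprD addrA
     subrr sub0r oppr_eq0 => /eqP.
have gE0 a : E a -> g a = D a.
  by move=> Ea; have := gE a 0 Ea E0; rewrite !(mul0r, addr0, D0).
exists g; split=> //; last first.
  by have := gE 0 1 E0 E1; rewrite !(mul0r, mul1r, add0r, D0, D1).
split.
- move=> _ _ [a [b [Ea Eb ->]]] [a' [b' [Ec Ed ->]]].
  have -> : a + b * s - (a' + b' * s) = (a - a') + (b - b') * s by ring.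
  by rewrite !gE //; [rewrite !DB //; ring | insub EF..].
- move=> _ _ [a [b [Ea Eb ->]]] [a' [b' [Ec Ed ->]]].
  have -> : (a + b * s) * (a' + b' * s) =
    (a * a' + b * b' * s ^+ 2) + (a * b' + b * a') * s by ring.
  rewrite !gE //; do ?by insub EF.
  move uE: (s ^+ 2) Es2 dE => u Eu dE.
  rewrite !(derivation_onD EF Dd) //; do ?by insub EF.
  rewrite [D (_ * _ * u)]DM 4?DM //; do ?by insub EF.
  by rewrite dE -uE; ring.
Qed.

End QuadraticExtension.

(** This form also covers [E s], where [adjoin E s] is [E] itself; it is what is
    available before [s] is known to be irrational. *)
Lemma adjoin_sqrt_subfield (K : fieldType) (E : K -> Prop) s :
  is_subfield E -> E (s ^+ 2) -> is_subfield (adjoin E s).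
Proof.
move=> EF Es2; have [Es|nEs] := pselect (E s); last exact: adjoin_subfield.
have adjE z : adjoin E s z -> E z by move=> [a [b [Ea Eb ->]]]; insub EF.
have Eadj z : E z -> adjoin E s z by apply: adjoin_sub.
split; first exact: Eadj (sub1 EF).
- by move=> a b /adjE Ea /adjE Eb; apply: Eadj; apply: (subB EF).
- by move=> a b /adjE Ea /adjE Eb; apply: Eadj; apply: (subM EF).
- by move=> a /adjE Ea; apply: Eadj; apply: (subV EF).
Qed.

(** * Rational functions of one element *)

Section Evaluation.
Variables (k K : fieldType) (kappa : {rmorphism k -> K}).

Definition ev (w : K) : {poly k} -> K :=
  horner_morph (fun c => mulrC w (kappa c)).
HB.instance Definition _ w := GRing.RMorphism.copy (ev w)
  (horner_morph (fun c => mulrC w (kappa c))).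

Lemma evE w P : ev w P = (map_poly kappa P).[w]. Proof. by []. Qed.
Lemma evC w c : ev w c%:P = kappa c. Proof. exact: horner_morphC. Qed.
Lemma evX w : ev w 'X = w. Proof. exact: horner_morphX. Qed.
Lemma evZ w c P : ev w (c *: P) = kappa c * ev w P.
Proof. by rewrite -mul_polyC rmorphM /= evC. Qed.
Lemma evXn w n : ev w 'X^n = w ^+ n.
Proof. by rewrite rmorphXn /= evX. Qed.

Lemma ev_poly_ind w (Q : K -> Prop) : (forall c, Q (kappa c)) ->
  (forall a c, Q a -> Q (a * w + kappa c)) -> forall P, Q (ev w P).
Proof.
move=> Qc Qa P; elim/poly_ind: P => [|P c IH]; first by rewrite -[0]polyC0 evC.
by rewrite rmorphD rmorphM /= evX evC; apply: Qa.
Qed.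

Lemma rmorph_ev (f : {rmorphism K -> K}) w P : (forall c, f (kappa c) = kappa c) ->
  f (ev w P) = ev (f w) P.
Proof.
move=> fk; rewrite !evE -horner_map /= -map_poly_comp.
by congr horner; apply: eq_map_poly => c /=.
Qed.

Definition transcendental (w : K) : Prop := forall P : {poly k}, ev w P = 0 -> P = 0.

Lemma ev_eq0 w P : transcendental w -> (ev w P == 0) = (P == 0).
Proof. by move=> tw; apply/eqP/eqP => [/tw //|->]; rewrite rmorph0. Qed.

Lemma ev_inj w P Q : transcendental w -> ev w P = ev w Q -> P = Q.
Proof.
by move=> tw eqPQ; apply/eqP; rewrite -subr_eq0 -(ev_eq0 _ tw) rmorphB /= eqPQ subrr.
Qed.

Lemma transcendental_neq w c : transcendental w -> w <> kappa c.
Proof.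
move=> tw /eqP; apply/negP; rewrite -subr_eq0 -{1}(evX w) -(evC w c).
by rewrite -rmorphB ev_eq0 // polyXsubC_eq0.
Qed.

Lemma transcendental_neq0 w : transcendental w -> w != 0.
Proof. by move=> tw; rewrite -(evX w) ev_eq0 // polyX_eq0. Qed.

Definition rational_in (w z : K) : Prop :=
  exists P Q : {poly k}, ev w Q != 0 /\ z = ev w P / ev w Q.

Lemma rational_ev w P : rational_in w (ev w P).
Proof. by exists P, 1; rewrite rmorph1 oner_eq0 divr1. Qed.

Lemma rational_const w c : rational_in w (kappa c).
Proof. by rewrite -(evC w); apply: rational_ev. Qed.

Lemma rational_gen w : rational_in w w.
Proof. by rewrite -{2}(evX w); apply: rational_ev. Qed.

Lemma rational_subfield w : is_subfield (rational_in w).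
Proof.
split; first by rewrite -(rmorph1 (ev w)); apply: rational_ev.
- move=> _ _ [P [Q [nzQ ->]]] [P' [Q' [nzQ' ->]]].
  exists (P * Q' - P' * Q), (Q * Q'); rewrite rmorphB !rmorphM mulf_neq0 //=.
  by split=> //; field; apply/andP.
- move=> _ _ [P [Q [nzQ ->]]] [P' [Q' [nzQ' ->]]].
  exists (P * P'), (Q * Q'); rewrite !rmorphM mulf_neq0 //=.
  by split=> //; field; apply/andP.
- move=> _ [P [Q [nzQ ->]]].
  have [->|nzP] := eqVneq (ev w P) 0.
    exists 0, 1; rewrite rmorph0 rmorph1 oner_eq0 !mul0r invr0.
    by [].
  by exists Q, P; rewrite invf_div.
Qed.

Lemma subfield_ev (E : K -> Prop) w : is_subfield E ->
  (forall c, E (kappa c)) -> E w -> forall P, E (ev w P).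
Proof. by move=> EF Ec Ew; apply: ev_poly_ind => // a c Ea; insub EF. Qed.

Lemma subfield_rational (E : K -> Prop) w : is_subfield E ->
  (forall c, E (kappa c)) -> E w -> forall z, rational_in w z -> E z.
Proof.
move=> EF Ec Ew _ [P [Q [_ ->]]].
by apply: (subM EF); [|apply: (subV EF)]; apply: subfield_ev.
Qed.

Lemma rational_hom w W : transcendental w -> transcendental W ->
  exists f, [/\ hom_on (rational_in w) f, forall c, f (kappa c) = kappa c & f w = W].
Proof.
move=> tw tW.
have /choice[f fP] : forall z, exists fz, forall P Q,
    Q != 0 -> z = ev w P / ev w Q -> fz = ev W P / ev W Q.
  move=> z; have [[P [Q [nzQ ->]]]|nz] := pselect (rational_in w z); last first.
    by exists 0 => P Q nzQ zE; case: nz; exists P, Q; rewrite ev_eq0.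
  rewrite ev_eq0 // in nzQ; exists (ev W P / ev W Q) => P' Q' nzQ' /eqP.
  rewrite eqr_div ?ev_eq0 // -!rmorphM => /eqP/(ev_inj tw) eqPQ.
  by apply/eqP; rewrite eqr_div ?ev_eq0 // -!rmorphM eqPQ.
have fE P Q : Q != 0 -> f (ev w P / ev w Q) = ev W P / ev W Q by move=> /fP; apply.
have fP1 P : f (ev w P) = ev W P.
  by have := fE P 1 (oner_neq0 _); rewrite !rmorph1 !divr1.
exists f; split; first split.
- by have := fP1 1; rewrite !rmorph1.
- move=> _ _ [P [Q [nzQ ->]]] [P' [Q' [nzQ' ->]]].
  have -> : ev w P / ev w Q - ev w P' / ev w Q' =
            ev w (P * Q' - P' * Q) / ev w (Q * Q').
    by rewrite rmorphB !rmorphM /=; field; apply/andP.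
  rewrite !ev_eq0 // in nzQ nzQ'.
  rewrite !fE ?mulf_neq0 // rmorphB !rmorphM /=; field.
  by rewrite !ev_eq0 // nzQ nzQ'.
- move=> _ _ [P [Q [nzQ ->]]] [P' [Q' [nzQ' ->]]].
  have -> : ev w P / ev w Q * (ev w P' / ev w Q') =
            ev w (P * P') / ev w (Q * Q').
    by rewrite !rmorphM /=; field; apply/andP.
  rewrite !ev_eq0 // in nzQ nzQ'.
  rewrite !fE ?mulf_neq0 // !rmorphM /=; field.
  by rewrite !ev_eq0 // nzQ nzQ'.
- by move=> c; rewrite -{1}(evC w) fP1 evC.
- by rewrite -{1}(evX w) fP1 evX.
Qed.

Lemma rational_derivation w : transcendental w ->
  exists D, derivation_on (rational_in w) D /\ forall P, D (ev w P) = ev w P^`().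
Proof.
move=> tw.
have /choice[D DP] : forall z, exists Dz, forall P Q, Q != 0 -> z = ev w P / ev w Q ->
    Dz = ev w (P^`() * Q - P * Q^`()) / ev w Q ^+ 2.
  move=> z; have [[P [Q [nzQ ->]]]|nz] := pselect (rational_in w z); last first.
    by exists 0 => P Q nzQ zE; case: nz; exists P, Q; rewrite ev_eq0.
  rewrite ev_eq0 // in nzQ.
  exists (ev w (P^`() * Q - P * Q^`()) / ev w Q ^+ 2) => P' Q' nzQ' /eqP.
  rewrite eqr_div ?ev_eq0 // -!rmorphM => /eqP/(ev_inj tw) eqPQ.
  apply/eqP; rewrite eqr_div ?expf_neq0 ?ev_eq0 // -!rmorphXn -!rmorphM; apply/eqP.
  congr (ev w _); have := congr1 (fun p => p^`()) eqPQ.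
  rewrite !derivM => eqD.
  have -> : (P^`() * Q - P * Q^`()) * Q' ^+ 2 =
    (P^`() * Q' + P * Q'^`()) * (Q * Q') - (P * Q') * (Q'^`() * Q + Q' * Q^`()) by ring.
  by rewrite eqD eqPQ; ring.
have DE P Q : Q != 0 -> D (ev w P / ev w Q) =
    ev w (P^`() * Q - P * Q^`()) / ev w Q ^+ 2 by move=> /DP; apply.
exists D; split; first split.
- move=> _ _ [P [Q [nzQ ->]]] [P' [Q' [nzQ' ->]]].
  have -> : ev w P / ev w Q - ev w P' / ev w Q' =
            ev w (P * Q' - P' * Q) / ev w (Q * Q').
    by rewrite rmorphB !rmorphM /=; field; apply/andP.
  rewrite !ev_eq0 // in nzQ nzQ'.
  rewrite !DE ?mulf_neq0 // !(derivM, derivB) !(rmorphB, rmorphD, rmorphM) /=.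
  by field; rewrite !ev_eq0 // nzQ nzQ'.
- move=> _ _ [P [Q [nzQ ->]]] [P' [Q' [nzQ' ->]]].
  have -> : ev w P / ev w Q * (ev w P' / ev w Q') =
            ev w (P * P') / ev w (Q * Q').
    by rewrite !rmorphM /=; field; apply/andP.
  rewrite !ev_eq0 // in nzQ nzQ'.
  rewrite !DE ?mulf_neq0 // !(derivM, derivB) !(rmorphB, rmorphD, rmorphM) /=.
  by field; rewrite !ev_eq0 // nzQ nzQ'.
- move=> P; have := DE P 1 (oner_neq0 _).
  rewrite rmorph1 divr1 => ->.
  by rewrite -polyC1 derivC mulr0 mulr1 subr0 expr1n divr1.
Qed.

End Evaluation.

(** Over an algebraically closed field every polynomial splits, so that the only
    algebraic elements are the constants. *)
Lemma transcendental_closed (k : closedFieldType) (K : fieldType)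
  (kappa : {rmorphism k -> K}) w :
  (forall c, w <> kappa c) -> transcendental kappa w.
Proof.
move=> w_new P; have [r ->] := closed_field_poly_normal P.
rewrite evZ rmorph_prod /= => /eqP; rewrite mulf_eq0 fmorph_eq0 => /orP[/eqP->|].
  by rewrite scale0r.
rewrite prodf_seq_eq0 => /hasP[c _ /=].
by rewrite rmorphB /= evX evC subr_eq0 => /eqP/w_new.
Qed.

Definition k_derivation (k K : fieldType) (kappa : {rmorphism k -> K}) (D : K -> K) :=
  derivation_on (fun=> True) D /\ forall c, D (kappa c) = 0.

(** * Derivations and biquadratic extensions *)

Section Derivations.
Variables (k K : fieldType) (kappa : {rmorphism k -> K}) (D : K -> K).
Hypothesis DD : k_derivation kappa D.

Lemma derB a b : D (a - b) = D a - D b.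
Proof. by case: DD => -[DB _] _; apply: DB. Qed.
Lemma derM a b : D (a * b) = D a * b + a * D b.
Proof. by case: DD => -[_ DM] _; apply: DM. Qed.
Lemma der0 : D 0 = 0. Proof. by have := derB 0 0; rewrite !subrr. Qed.
Lemma derN a : D (- a) = - D a. Proof. by rewrite -sub0r derB der0 sub0r. Qed.
Lemma derD a b : D (a + b) = D a + D b.
Proof. by have := derB a (- b); rewrite derN !opprK. Qed.
Lemma der_const c : D (kappa c) = 0. Proof. by case: DD. Qed.
Lemma derXn a n : D (a ^+ n.+1) = n.+1%:R * a ^+ n * D a.
Proof.
elim: n => [|n IHn]; first by rewrite expr0 expr1 !mul1r.
by rewrite exprS derM IHn [n.+2%:R]mulrS exprS; ring.
Qed.
Lemma derV a : D a^-1 = - (a ^- 2 * D a).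
Proof.
have [->|nz_a] := eqVneq a 0; first by rewrite invr0 der0 mulr0 oppr0.
have := congr1 D (divff nz_a); rewrite derM -(rmorph1 kappa) der_const => /eqP.
rewrite addrC addr_eq0 => /eqP eqD.
apply: (mulfI nz_a); rewrite eqD; field.
by [].
Qed.
Lemma der_ev w P : D (ev kappa w P) = ev kappa w P^`() * D w.
Proof.
elim/poly_ind: P => [|P c IH]; first by rewrite deriv0 rmorph0 der0 mul0r.
rewrite derivD derivM derivX derivC addr0 mulr1 !rmorphD !rmorphM /= !evX evC.
by rewrite derD derM IH der_const; ring.
Qed.

End Derivations.

(** Two successive quadratic extensions of [k(w)]: homomorphisms and derivations
    are built floor by floor, which replaces the uniqueness up to isomorphism of
    the function field. *)
Section Biquadratic.
Variables (k K : fieldType) (kappa : {rmorphism k -> K}) (w s t : K) (ps pt : {poly k}).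
Hypotheses (tw : transcendental kappa w) (s2 : s ^+ 2 = ev kappa w ps)
  (t2 : t ^+ 2 = ev kappa w pt) (nz2 : 2 != 0 :> K).
Let E0 := rational_in kappa w.
Let E1 := adjoin E0 s.
Hypotheses (ns : ~ E0 s) (nt : ~ E1 t) (genK : forall z, adjoin E1 t z).

Let EF0 : is_subfield E0. Proof. exact: rational_subfield. Qed.
Let E0s2 : E0 (s ^+ 2). Proof. by rewrite s2; apply: rational_ev. Qed.
Let EF1 : is_subfield E1. Proof. exact: adjoin_subfield. Qed.
Let E1t2 : E1 (t ^+ 2).
Proof. by rewrite t2; apply: adjoin_sub => //; apply: rational_ev. Qed.
Let nzs : s != 0.
Proof. by apply/eqP => s0; apply: ns; rewrite s0; apply: sub0. Qed.
Let nzt : t != 0.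
Proof. by apply/eqP => t0; apply: nt; rewrite t0; apply: sub0. Qed.

Lemma biquadratic_gen (E : K -> Prop) : is_subfield E ->
  (forall c, E (kappa c)) -> E w -> E s -> E t -> forall z, E z.
Proof.
move=> EF Ec Ew Es Et z; have [a [b [Ea Eb ->]]] := genK z.
have E0E := subfield_rational EF Ec Ew.
have E1E c : E1 c -> E c by case=> [u [v [/E0E Eu /E0E Ev ->]]]; insub EF.
by move: (E1E _ Ea) (E1E _ Eb) => {}Ea {}Eb; insub EF.
Qed.

Lemma biquadratic_hom W S T : transcendental kappa W ->
  S ^+ 2 = ev kappa W ps -> T ^+ 2 = ev kappa W pt ->
  exists f : {rmorphism K -> K},
    [/\ forall c, f (kappa c) = kappa c, f w = W, f s = S & f t = T].
Proof.
move=> tW S2 T2.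
have [f0 [f0h f0c f0w]] := rational_hom tw tW.
have f0ev P : f0 (ev kappa w P) = ev kappa W P.
  have [f01 f0B f0M] := f0h.
  elim/poly_ind: P => [|P c IH]; first by rewrite -polyC0 !evC f0c.
  rewrite !rmorphD !rmorphM /= !evX !evC (hom_onD EF0 f0h) ?f0M ?f0w ?f0c ?IH //.
  - exact: rational_ev.
  - exact: rational_gen.
  - by apply: (subM EF0); [apply: rational_ev|apply: rational_gen].
  - exact: rational_const.
have [|f1 [f1h f1E f1s]] := @adjoin_hom _ E0 s EF0 E0s2 ns f0 S f0h.
  by rewrite s2 f0ev.
have [|f [[f_1 fB fM] fE ft]] := @adjoin_hom _ E1 t EF1 E1t2 nt f1 T f1h.
  by rewrite t2 f1E ?f0ev //; apply: rational_ev.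
have fa : zmod_morphism f by move=> a b; rewrite fB.
have fm : monoid_morphism f by split=> // a b; rewrite fM.
pose aM := GRing.isZmodMorphism.Build K K f fa.
pose mM := GRing.isMonoidMorphism.Build K K f fm.
pose F : {rmorphism K -> K} := HB.pack f aM mM.
have FE a : E0 a -> f a = f0 a.
  by move=> Ea; rewrite fE ?f1E //; apply: adjoin_sub.
exists F; split=> //=.
- by move=> c; rewrite FE ?f0c //; apply: rational_const.
- by rewrite FE ?f0w //; apply: rational_gen.
- by rewrite fE //; apply: adjoin_gen.
Qed.

Lemma biquadratic_derivation : exists D, k_derivation kappa D /\ D w = 1.
Proof.
have [D0 [D0d D0ev]] := rational_derivation tw.
have [D1 [D1d D1E _]] := @adjoin_derivation _ E0 s EF0 E0s2 ns D0 D0d nzs nz2.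
have [D [[DB DM] DE _]] := @adjoin_derivation _ E1 t EF1 E1t2 nt D1 D1d nzt nz2.
have DP P : D (ev kappa w P) = ev kappa w P^`().
  have Ev := rational_ev kappa w P.
  by rewrite DE ?D1E //; apply: adjoin_sub.
exists D; split; [split; [split=> a b _ _|move=> c]|].
- exact: DB.
- exact: DM.
- by rewrite -(evC _ w) DP derivC rmorph0.
- by rewrite -{1}(evX kappa w) DP derivX rmorph1.
Qed.

Lemma biquadratic_hom_eq (f g : {rmorphism K -> K}) :
  (forall c, f (kappa c) = g (kappa c)) -> f w = g w -> f s = g s -> f t = g t ->
  f =1 g.
Proof.
move=> fc fw fs ft; apply: biquadratic_gen => //; split; first by rewrite !rmorph1.
- by move=> a b; rewrite !rmorphB => -> ->.
- by move=> a b; rewrite !rmorphM => -> ->.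
- by move=> a; rewrite !fmorphV => ->.
Qed.

Lemma biquadratic_derivation_eq D D' : k_derivation kappa D -> k_derivation kappa D' ->
  D w = D' w -> D =1 D'.
Proof.
move=> DD DD' eq_w.
have sq u P : u != 0 -> u ^+ 2 = ev kappa w P -> D u = D' u.
  move=> nzu u2; have := congr1 D u2; have := congr1 D' u2.
  rewrite (derXn DD) (derXn DD') (der_ev DD) (der_ev DD') eq_w => <-.
  by apply: mulfI; rewrite mulf_neq0 // expf_neq0.
apply: biquadratic_gen => //; last 2 first.
- exact: sq s2.
- exact: sq t2.
- split; first by rewrite -(rmorph1 kappa) (der_const DD) (der_const DD').
  + by move=> a b; rewrite (derB DD) (derB DD') => -> ->.
  + by move=> a b; rewrite (derM DD) (derM DD') => -> ->.
  + by move=> a; rewrite (derV DD) (derV DD') => ->.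
- by move=> c; rewrite (der_const DD) (der_const DD').
Qed.

End Biquadratic.

(** * Integral elements *)

Lemma exprD_split (R : pzSemiRingType) (a : R) d j : (j < d.+1)%N ->
  a ^+ d = a ^+ (d - j) * a ^+ j.
Proof. by rewrite ltnS -exprD => /subnK->. Qed.

Section Kronecker.
Variables (R : comNzRingType) (K : fieldType) (RtoK : {rmorphism R -> K}).
Notation int := (integralOver RtoK).

Lemma integral_exp a n : int a -> int (a ^+ n).
Proof.
move=> ia; elim: n => [|n IHn]; first exact: integral1.
by rewrite exprS; apply: integral_mul.
Qed.

Lemma integral_sqrt a : int (a ^+ 2) -> int a.
Proof.
move=> ia; apply: (@integral_root_monic _ _ RtoK a ('X^2 - (a ^+ 2)%:P)).
- exact: monicXnsubC.
- by rewrite rootE !hornerE subrr.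
- apply/integral_poly => j; rewrite coefB coefXn coefC; apply: integral_sub.
    exact: integral_nat.
  by case: ifP => // _; apply: integral0.
Qed.

(** With [d] the degree and [a] the leading coefficient, [a ^+ d.-1] times the
    equation of [z] is a monic equation of [a * z]. *)
Lemma integral_lead_coef_root (p : {poly K}) z :
  (forall j, int p`_j) -> root p z -> int (lead_coef p * z).
Proof.
move=> ip pz; have [->|nzp] := eqVneq p 0.
  by rewrite lead_coef0 mul0r; apply: integral0.
have [d sp] : exists d, size p = d.+2.
  have: (1 < size p)%N by apply: root_size_gt1 pz.
  by case: (size p) => [|[|d]] // _; exists d.
set a := lead_coef p.
pose r := \poly_(j < d.+1) (p`_j * a ^+ (d - j)).
have sr : (size r < size ('X^(d.+1) : {poly K}))%N by rewrite size_polyXn ltnS size_poly.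
apply: (@integral_root_monic _ _ RtoK _ ('X^(d.+1) + r)).
- by rewrite monicE lead_coefDl // lead_coefXn.
- have -> : root ('X^(d.+1) + r) (a * z) = (a ^+ d * p.[z] == 0).
    have -> : p.[z] = \sum_(j < d.+1) p`_j * z ^+ j + a * z ^+ d.+1.
      by rewrite horner_coef sp big_ord_recr /= /a lead_coefE sp.
    rewrite rootE hornerD hornerXn horner_poly mulrDr addrC mulr_sumr; congr (_ + _ == 0).
      by apply: eq_bigr => j _; rewrite exprMn (exprD_split a (ltn_ord j)); ring.
    by rewrite exprMn exprS; ring.
  by rewrite (rootP pz) mulr0.
- apply/integral_poly => j; rewrite coefD coefXn; apply: integral_add.
    exact: integral_nat.
  rewrite coef_poly; case: ifP => _; last exact: integral0.
  by apply: integral_mul => //; apply: integral_exp; apply: ip.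
Qed.

Lemma coef_mulXsubC (q : {poly K}) z j :
  (q * ('X - z%:P))`_j = (if j is j'.+1 then q`_j' else 0) - q`_j * z.
Proof. by rewrite mulrBr coefB coefMX coefMC; case: j. Qed.

(** Kronecker's lemma. If [a] is the leading coefficient of [q] and [d] its
    degree, subtracting [a 'X^d ('X - z)] from the product removes the top term
    of [q] and keeps the coefficients integral, because [a z] is integral. *)
Lemma kronecker_quotient (q : {poly K}) z :
  (forall j, int (q * ('X - z%:P))`_j) -> forall j, int q`_j /\ int (q`_j * z).
Proof.
move=> iqz.
suff iq j : int q`_j.
  move=> j; split=> //; have := iqz j; rewrite coef_mulXsubC => ij.
  rewrite -[_ * z](subKr (if j is j'.+1 then q`_j' else 0)).
  by apply: integral_sub => //; case: (j) => // ; apply: integral0.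
move: {2}(size q) (leqnn (size q)) => n.
elim: n q iqz j => [|n IHn] q iqz j sq.
  by move: sq; rewrite leqn0 size_poly_eq0 => /eqP->; rewrite coef0; apply: integral0.
have [->|nzq] := eqVneq q 0; first by rewrite coef0; apply: integral0.
have [d sqE] : exists d, size q = d.+1.
  by exists (size q).-1; rewrite prednK // size_poly_gt0.
set a := lead_coef q.
have lq : lead_coef (q * ('X - z%:P)) = a by rewrite lead_coef_Mmonic ?monicXsubC.
have iaz : int (a * z).
  rewrite -lq; apply: integral_lead_coef_root => //.
  by rewrite rootM root_XsubC eqxx orbT.
have ia : int a by rewrite -lq lead_coefE; apply: iqz.
pose q' := q - a *: 'X^d.
have qE : q = q' + a *: 'X^d by rewrite subrK.
have iXd i : int (a *: 'X^d : {poly K})`_i.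
  by rewrite coefZ coefXn; apply: integral_mul => //; apply: integral_nat.
rewrite qE coefD; apply: integral_add => //; apply: IHn.
- move=> i; have := iqz i; rewrite {1}qE mulrDl coefD => iq.
  rewrite -[X in int X](addrK ((a *: 'X^d) * ('X - z%:P))`_i).
  apply: integral_sub => //; rewrite coef_mulXsubC; apply: integral_sub.
    by case: (i) => [|i']; [apply: integral0 | apply: iXd].
  rewrite coefZ -mulrA [_ * z]mulrC mulrA; apply: integral_mul => //.
  by rewrite coefXn; apply: integral_nat.
- rewrite -ltnS -/(size q' < n.+1)%N; apply: leq_trans sq; rewrite sqE ltnS.
  apply/leq_sizeP => i; rewrite leq_eqVlt coefB coefZ coefXn => /orP[/eqP<-|lt_di].
    by rewrite eqxx mulr1 /a lead_coefE sqE subrr.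
  by rewrite gtn_eqF // mulr0 subr0; apply: nth_default; rewrite sqE.
Qed.

End Kronecker.

Lemma coprimep_bezout (k : fieldType) (P Q : {poly k}) : coprimep P Q ->
  exists A B, A * P + B * Q = 1.
Proof.
move=> /Bezout_coprimepP[[A B] /=]; rewrite -size_poly_eq1 => /size_poly1P[c nzc AB].
exists (c^-1 *: A), (c^-1 *: B).
by rewrite -!scalerAl -scalerDr AB -mul_polyC -polyCM mulVf.
Qed.

Section CoprimeFractions.
Variables (k K : fieldType) (kappa : {rmorphism k -> K}) (w : K).
Hypothesis tw : transcendental kappa w.
Notation ev := (ev kappa w).
Notation int := (integralOver ev).

Lemma rational_coprime z : rational_in kappa w z ->
  exists P Q, [/\ coprimep P Q, Q != 0 & z = ev P / ev Q].
Proof.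
move=> [P [Q []]]; rewrite ev_eq0 // => nzQ ->.
have nzg : gcdp P Q != 0 by rewrite gcdp_eq0 negb_and nzQ orbT.
exists (P %/ gcdp P Q), (Q %/ gcdp P Q); split.
- by apply: coprimep_div_gcd; rewrite nzQ orbT.
- by apply: contraNneq nzQ => Q0; rewrite -(divpK (dvdp_gcdr P Q)) Q0 mul0r.
- have -> : ev P = ev (P %/ gcdp P Q) * ev (gcdp P Q).
    by rewrite -rmorphM divpK ?dvdp_gcdl.
  have -> : ev Q = ev (Q %/ gcdp P Q) * ev (gcdp P Q).
    by rewrite -rmorphM divpK ?dvdp_gcdr.
  by rewrite invfM mulrACA divff ?ev_eq0 // mulr1.
Qed.

(** Clearing denominators in a monic equation of [P / Q], in lowest terms, shows
    that [Q] divides a power of [P]. *)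
Lemma integral_rational z : int z -> rational_in kappa w z -> exists P, z = ev P.
Proof.
move=> [p mp pz] /rational_coprime[P [Q [cPQ nzQ zE]]].
have [d sp] : exists d, size p = d.+1.
  by exists (size p).-1; rewrite prednK // size_poly_gt0 monic_neq0.
have pd : p`_d = 1 by move: (monicP mp); rewrite lead_coefE sp.
have nzeQ : ev Q != 0 by rewrite ev_eq0.
have sum0 : \sum_(j < d.+1) p`_j * P ^+ j * Q ^+ (d - j) = 0.
  apply: tw; rewrite rmorph_sum /=.
  transitivity (ev Q ^+ d * (map_poly ev p).[z]); last by rewrite (rootP pz) mulr0.
  rewrite horner_coef size_map_poly_id0; last first.
    by rewrite (monicP mp) rmorph1 oner_neq0.
  rewrite sp mulr_sumr; apply: eq_bigr => j _.
  rewrite !rmorphM !rmorphXn /= coef_map zE /= expr_div_n.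
  rewrite (exprD_split (ev Q) (ltn_ord j)).
  by field; rewrite expf_neq0.
have : Q %| P ^+ d.
  move: sum0; rewrite big_ord_recr /= subnn pd expr0 mulr1 mul1r => /eqP.
  rewrite addrC addr_eq0 => /eqP->; rewrite dvdpNr; apply: (big_ind (fun r => Q %| r)).
  - exact: dvdp0.
  - by move=> a b; apply: dvdp_add.
  - move=> j _; apply: dvdp_mull; have := ltn_ord j; rewrite -subn_gt0.
    by case: (d - j)%N => // e _; rewrite exprS; apply: dvdp_mulr.
rewrite -(mul1r (P ^+ d)) Gauss_dvdpl; last by rewrite coprimep_expr // coprimep_sym.
rewrite dvdp1 => /size_poly1P[c nzc QE].
exists (c^-1 *: P); rewrite zE QE evC evZ mulrC fmorphV.
by [].
Qed.

(** The square of the denominator of [z] divides [P], which is square-free. *)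
Lemma square_free_denominator z (P : {poly k}) : separable_poly P ->
  rational_in kappa w z -> int (z ^+ 2 * ev P) -> exists Q, z = ev Q.
Proof.
move=> sepP rz iz.
have [R RE] : exists R, z ^+ 2 * ev P = ev R.
  apply: integral_rational => //; have EF := rational_subfield kappa w.
  by apply: (subM EF); [apply: (subX _ EF)|apply: rational_ev].
have [A [B [cAB nzB zE]]] := rational_coprime rz.
have /(ev_inj tw) eqAB : ev (A ^+ 2 * P) = ev (R * B ^+ 2).
  by rewrite !rmorphM /= -RE zE; field; rewrite ev_eq0.
have : B ^+ 2 %| P.
  have : B ^+ 2 %| A ^+ 2 * P by rewrite eqAB dvdp_mull.
  by rewrite Gauss_dvdpr // coprimep_expl // coprimep_expr // coprimep_sym.
have [/eqP/size_poly1P[c nzc BE] _|szB] := eqVneq (size B) 1%N; last first.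
  by rewrite separable_nosquare.
by exists (c^-1 *: A); rewrite zE BE evC evZ mulrC fmorphV.
Qed.

End CoprimeFractions.

(** * Traces of regular differentials *)

(** [K] is a biquadratic extension of [k(w)] whose Galois group is generated by
    [al] and [be]; [s1], [s2], [s3] span the three nontrivial eigenspaces. *)
Section TraceForm.
Variables (k K : fieldType) (kappa : {rmorphism k -> K}) (w : K).
Notation evaluate := (ev kappa).
Notation ev := (ev kappa w).
Notation int := (integralOver ev).
Hypotheses (tw : transcendental kappa w) (nz2 : 2 != 0 :> k).
Variables (al be : {rmorphism K -> K}).
Hypotheses (al_const : forall c, al (kappa c) = kappa c) (al_w : al w = w)
  (be_const : forall c, be (kappa c) = kappa c) (be_w : be w = w)
  (alK : involutive al) (beK : involutive be) (al_be : forall z, al (be z) = be (al z))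
  (fixedE : forall z, al z = z -> be z = z -> rational_in kappa w z).
Variables (s1 s2 s3 : K) (p1 p2 p3 : {poly k}).
Hypotheses (nz1 : s1 != 0) (nz_s2 : s2 != 0) (nz3 : s3 != 0)
  (al1 : al s1 = - s1) (be1 : be s1 = s1) (al2 : al s2 = s2) (be2 : be s2 = - s2)
  (al3 : al s3 = - s3) (be3 : be s3 = - s3)
  (sq1 : s1 ^+ 2 = ev p1) (sq2 : s2 ^+ 2 = ev p2) (sq3 : s3 ^+ 2 = ev p3)
  (sep1 : separable_poly p1) (sep2 : separable_poly p2) (sep3 : separable_poly p3).
Variable D : K -> K.
Hypotheses (DD : k_derivation kappa D) (Dw : D w = 1).

Definition klein_trace (f g : K -> K) (z : K) := z + f z + g z + f (g z).
Notation Tr := (klein_trace al be).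

Let al_ev P : al (ev P) = ev P. Proof. by rewrite rmorph_ev ?al_w. Qed.
Let be_ev P : be (ev P) = ev P. Proof. by rewrite rmorph_ev ?be_w. Qed.

Let nz2K : 2 != 0 :> K. Proof. by rewrite -(rmorph_nat kappa) fmorph_eq0. Qed.

Lemma integral_const c : int (kappa c).
Proof. by rewrite -(evC kappa w); apply: integral_id. Qed.

Lemma integral_al z : int z -> int (al z).
Proof.
move=> [p mp pz]; exists p => //.
have -> : map_poly ev p = map_poly al (map_poly ev p).
  by rewrite -map_poly_comp; apply: eq_map_poly => P /=; rewrite al_ev.
by rewrite fmorph_root.
Qed.

Lemma integral_be z : int z -> int (be z).
Proof.
move=> [p mp pz]; exists p => //.
have -> : map_poly ev p = map_poly be (map_poly ev p).
  by rewrite -map_poly_comp; apply: eq_map_poly => P /=; rewrite be_ev.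
by rewrite fmorph_root.
Qed.

Lemma trace_fixed z : al (Tr z) = Tr z /\ be (Tr z) = Tr z.
Proof. by rewrite /klein_trace !rmorphD /= -!al_be !(alK, beK); split; ring. Qed.

Lemma trace_rational z : rational_in kappa w (Tr z).
Proof. by have [] := trace_fixed z; apply: fixedE. Qed.

Lemma integral_trace z : int z -> exists P, Tr z = ev P.
Proof.
move=> iz; apply: (integral_rational tw); last exact: trace_rational.
by do ![apply: integral_add|apply: integral_al|apply: integral_be].
Qed.

(** An integral element of the eigenspace of [s] is [s] times a rational function,
    whose denominator is trivial because [s ^+ 2] is square-free. *)
Lemma integral_eigen (e s : K) (P : {poly k}) : s != 0 -> s ^+ 2 = ev P ->
  separable_poly P -> int e -> al (e / s) = e / s -> be (e / s) = e / s ->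
  exists Q, e = ev Q * s.
Proof.
move=> nz_s s_sq sepP ie fa fb.
have [||Q QE] := @square_free_denominator _ _ kappa w tw (e / s) P sepP.
- exact: fixedE.
- by rewrite -s_sq -exprMn divfK //; apply: integral_exp.
- by exists Q; rewrite -QE divfK.
Qed.

(** The projections to the eigenspaces preserve integrality up to the factor [4],
    which is invertible. *)
Lemma integral_coords z : int z -> exists a b c d,
  z = ev a + ev b * s1 + ev c * s2 + ev d * s3.
Proof.
move=> iz.
have ial := integral_al; have ibe := integral_be.
have [a aE] := integral_trace iz.
have [|||b bE] := @integral_eigen (z - al z + be z - al (be z)) s1 p1 nz1 sq1 sep1.
- by repeat first [ assumption | apply: integral_sub | apply: integral_add
    | apply: ial | apply: ibe ].
- rewrite fmorph_div !(rmorphD, rmorphN, rmorphB) /= al1 !alK invrN mulrN -mulNr.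
  by congr (_ / _); ring.
- rewrite fmorph_div !(rmorphD, rmorphN, rmorphB) /= be1 -!al_be !beK.
  by congr (_ / _); ring.
have [|||c cE] := @integral_eigen (z + al z - be z - al (be z)) s2 p2 nz_s2 sq2 sep2.
- by repeat first [ assumption | apply: integral_sub | apply: integral_add
    | apply: ial | apply: ibe ].
- rewrite fmorph_div !(rmorphD, rmorphN, rmorphB) /= al2 !alK.
  by congr (_ / _); ring.
- rewrite fmorph_div !(rmorphD, rmorphN, rmorphB) /= be2 -!al_be !beK invrN mulrN -mulNr.
  by congr (_ / _); ring.
have [|||d dE] := @integral_eigen (z - al z - be z + al (be z)) s3 p3 nz3 sq3 sep3.
- by repeat first [ assumption | apply: integral_sub | apply: integral_add
    | apply: ial | apply: ibe ].
- rewrite fmorph_div !(rmorphD, rmorphN, rmorphB) /= al3 !alK invrN mulrN -mulNr.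
  by congr (_ / _); ring.
- rewrite fmorph_div !(rmorphD, rmorphN, rmorphB) /= be3 -!al_be !beK invrN mulrN -mulNr.
  by congr (_ / _); ring.
exists (4^-1 *: a), (4^-1 *: b), (4^-1 *: c), (4^-1 *: d).
have nz4 : 4 != 0 :> K by rewrite (_ : 4 = 2 * 2) ?mulf_neq0 // -natrM.
rewrite !evZ -!mulrA -aE -bE -cE -dE fmorphV rmorph_nat /klein_trace; field.
by [].
Qed.

(** The inverse different: the dual of the ring of integers for the trace form.
    It stands for the differentials [h dw] without poles above finite [w]. *)
Definition codifferent (h : K) : Prop := forall b, int b -> exists P, Tr (h * b) = ev P.

Lemma codifferentM h b : codifferent h -> int b -> codifferent (b * h).
Proof.
by move=> ch ib c ic; rewrite [b * h]mulrC -mulrA; apply/ch/integral_mul.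
Qed.

Lemma codifferentD h h' : codifferent h -> codifferent h' -> codifferent (h + h').
Proof.
move=> ch ch' b ib; have [P PE] := ch b ib; have [P' PE'] := ch' b ib.
exists (P + P'); rewrite rmorphD /= -PE -PE' /klein_trace mulrDl !rmorphD /=; ring.
Qed.

Lemma codifferent0 : codifferent 0.
Proof. by move=> b _; exists 0; rewrite /klein_trace mul0r !rmorph0 !addr0. Qed.

Let fixed a := al a = a /\ be a = a.

Lemma trace_mul (a0 a1 a2 a3 b0 b1 b2 b3 : K) :
  fixed a0 -> fixed a1 -> fixed a2 -> fixed a3 ->
  fixed b0 -> fixed b1 -> fixed b2 -> fixed b3 ->
  Tr ((a0 + a1 * s1 + a2 * s2 + a3 * s3) * (b0 + b1 * s1 + b2 * s2 + b3 * s3)) =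
  4 * (a0 * b0 + a1 * b1 * s1 ^+ 2 + a2 * b2 * s2 ^+ 2 + a3 * b3 * s3 ^+ 2).
Proof.
have alE c0 c1 c2 c3 : fixed c0 -> fixed c1 -> fixed c2 -> fixed c3 ->
    al (c0 + c1 * s1 + c2 * s2 + c3 * s3) = c0 - c1 * s1 + c2 * s2 - c3 * s3.
  move=> [f0 _] [f1 _] [f2 _] [f3 _].
  by rewrite !rmorphD !rmorphM /= f0 f1 f2 f3 al1 al2 al3 !mulrN.
have beE c0 c1 c2 c3 : fixed c0 -> fixed c1 -> fixed c2 -> fixed c3 ->
    be (c0 + c1 * s1 + c2 * s2 + c3 * s3) = c0 + c1 * s1 - c2 * s2 - c3 * s3.
  move=> [_ f0] [_ f1] [_ f2] [_ f3].
  by rewrite !rmorphD !rmorphM /= f0 f1 f2 f3 be1 be2 be3 !mulrN.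
have fixN c : fixed c -> fixed (- c) by move=> [ca cb]; split; rewrite rmorphN /= ?ca ?cb.
move=> fa0 fa1 fa2 fa3 fb0 fb1 fb2 fb3.
by rewrite /klein_trace !rmorphM /= !(alE, beE) // -!mulNr !alE ?fixN //; try exact: fixN; ring.
Qed.

(** Differentials of integral elements are regular. In coordinates, the poles of
    [D s = P' / (2 s)] are absorbed by the factor [s] that the trace requires. *)
Lemma codifferent_der z : int z -> codifferent (D z).
Proof.
move=> /integral_coords[a [b [c [d ->]]]] _ /integral_coords[a' [b' [c' [d' ->]]]].
have Dsq s P : s != 0 -> s ^+ 2 = ev P -> D s = ev (2^-1 *: P^`()) * s^-1.
  move=> nz_s s_sq; have := congr1 D s_sq; rewrite (derXn DD) (der_ev DD) Dw mulr1 expr1.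
  by rewrite evZ fmorphV rmorph_nat => <-; field; apply/andP.
rewrite !(derD DD, derM DD) !(der_ev DD) !Dw !mulr1.
rewrite (Dsq _ _ nz1 sq1) (Dsq _ _ nz_s2 sq2) (Dsq _ _ nz3 sq3).
set q1 := _ *: p1^`(); set q2 := _ *: p2^`(); set q3 := _ *: p3^`().
have coord s P (e f : {poly k}) : s != 0 -> s ^+ 2 = ev P ->
    ev e * s + ev f * s^-1 = (ev e + ev f / ev P) * s.
  by move=> nz_s <-; field.
have fix_ev P : fixed (ev P) by [].
have fix_div P Q R : fixed (ev P + ev Q / ev R).
  by split; rewrite rmorphD rmorphM fmorphV /= ?al_ev ?be_ev.
rewrite !mulrA -!rmorphM !addrA.
have -> : forall x1 x2 x3 y1 y2 y3 : K, ev a^`() + y1 + x1 + y2 + x2 + y3 + x3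
   = ev a^`() + (y1 + x1) + (y2 + x2) + (y3 + x3) by move=> *; ring.
rewrite (coord _ _ _ _ nz1 sq1) (coord _ _ _ _ nz_s2 sq2) (coord _ _ _ _ nz3 sq3).
rewrite trace_mul //.
exists (4 * (a^`() * a' + (b^`() * p1 + b * q1) * b' + (c^`() * p2 + c * q2) * c'
   + (d^`() * p3 + d * q3) * d')).
have canc s P (e f : {poly k}) : s != 0 -> s ^+ 2 = ev P -> (ev e + ev f / ev P) * s ^+ 2 =
   ev (e * P + f).
  by move=> nz_s sP; rewrite rmorphD rmorphM /= -sP; field.
rewrite ![_ * _ * _ ^+ 2]mulrAC (canc _ _ _ _ nz1 sq1) (canc _ _ _ _ nz_s2 sq2).
rewrite (canc _ _ _ _ nz3 sq3).
by rewrite -!rmorphM -!rmorphD [RHS]rmorphM rmorph_nat.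
Qed.

(** Localisations at [e] of the ring of integers and of its inverse different. *)
Definition integral_away (e z : K) : Prop := exists n, int (e ^+ n * z).
Definition codifferent_away (e h : K) : Prop := exists n, codifferent (e ^+ n * h).

Section Away.
Variable e : K.
Hypothesis ie : int e.

Lemma away_integral z : int z -> integral_away e z.
Proof. by exists 0; rewrite mul1r. Qed.

Lemma integral_awayM z z' : integral_away e z -> integral_away e z' ->
  integral_away e (z * z').
Proof.
move=> [m im] [n jn]; exists (m + n)%N; rewrite exprD mulrACA.
exact: integral_mul.
Qed.

Lemma integral_awayD z z' : integral_away e z -> integral_away e z' ->
  integral_away e (z + z').
Proof.
move=> [m im] [n jn]; exists (m + n)%N; rewrite mulrDr; apply: integral_add.
  by rewrite exprD mulrAC mulrC; apply: integral_mul => //; apply: integral_exp.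
by rewrite exprD -mulrA; apply: integral_mul => //; apply: integral_exp.
Qed.

Lemma integral_away_ev u P : integral_away e u -> integral_away e (evaluate u P).
Proof.
move=> iu; elim/poly_ind: P => [|P c IH].
  by rewrite rmorph0; apply/away_integral/integral0.
rewrite rmorphD rmorphM /= evX evC; apply: integral_awayD.
  exact: integral_awayM.
exact/away_integral/integral_const.
Qed.

Lemma integral_away_sqrt z : integral_away e (z ^+ 2) -> integral_away e z.
Proof.
move=> [n jn]; exists n; apply: integral_sqrt.
by rewrite exprMn expr2 -mulrA; apply: integral_mul => //; apply: integral_exp.
Qed.

Lemma codifferent_awayM z h : integral_away e z -> codifferent_away e h ->
  codifferent_away e (z * h).
Proof.
move=> [m im] [n cn]; exists (m + n)%N; rewrite exprD mulrACA.
exact: codifferentM.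
Qed.

Lemma codifferent_awayD h h' : codifferent_away e h -> codifferent_away e h' ->
  codifferent_away e (h + h').
Proof.
move=> [m cm] [n cn]; exists (m + n)%N; rewrite mulrDr; apply: codifferentD.
  rewrite exprD mulrAC mulrC; apply: codifferentM => //; exact: integral_exp.
by rewrite exprD -mulrA; apply: codifferentM => //; apply: integral_exp.
Qed.

Lemma codifferent_away_der z : integral_away e z -> codifferent_away e (D z).
Proof.
move=> [n jn]; exists (n + n)%N.
have -> : e ^+ (n + n) * D z = e ^+ n * D (e ^+ n * z) + - (e ^+ n * z) * D (e ^+ n).
  by rewrite exprD (derM DD); ring.
have ien : int (e ^+ n) by apply: integral_exp.
apply: codifferentD; apply: codifferentM; rewrite ?codifferent_der //; last exact: integral_opp.
all: exact: codifferent_der.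
Qed.

(** On the affine curve [S ^+ 2 = P.[u]], with [P] separable, the form [du / S]
    is regular: from [1 = A P + B P'] it equals [A S du + 2 B dS]. *)
Lemma codifferent_away_form u S P j : separable_poly P -> S != 0 ->
  S ^+ 2 = evaluate u P -> integral_away e u -> codifferent_away e (u ^+ j * D u / S).
Proof.
move=> sepP nzS S2 iu.
have iS : integral_away e S.
  by apply: integral_away_sqrt; rewrite S2; apply: integral_away_ev.
have [A [B AB]] : exists A B, A * P + B * P^`() = 1.
  by apply: coprimep_bezout; move: sepP; rewrite unlock.
have DS : 2 * S * D S = evaluate u P^`() * D u.
  by have := congr1 D S2; rewrite (derXn DD) (der_ev DD) expr1.
have {AB}AB : evaluate u A * S ^+ 2 + evaluate u B * evaluate u P^`() = 1.
  by rewrite S2 -!rmorphM -rmorphD AB rmorph1.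
have -> : u ^+ j * D u / S =
    evaluate u ('X^j * A) * S * D u + evaluate u (2 *: ('X^j * B)) * D S.
  apply: (mulIf nzS); rewrite divfK // evZ !rmorphM /= evXn rmorph_nat.
  transitivity (u ^+ j * D u *
    (evaluate u A * S ^+ 2 + evaluate u B * evaluate u P^`())).
    by rewrite AB mulr1.
  transitivity (u ^+ j * (evaluate u A * S ^+ 2 * D u
      + evaluate u B * (evaluate u P^`() * D u))); first by ring.
  by rewrite -DS; ring.
have iev Q := integral_away_ev Q iu.
by apply: codifferent_awayD; apply: codifferent_awayM; rewrite ?codifferent_away_der //;
  try exact: codifferent_away_der; apply: integral_awayM.
Qed.

End Away.

(** The ring [k[w]] is principal: [g] inverts a generator of the fractional ideal
    generated by [l]. That the multiples [g a] then generate the unit ideal is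
    expressed by quantifying over all [k[w]]-submodules [J]. *)
Lemma content_normalization (l : seq K) : {in l, forall a, rational_in kappa w a} ->
  (forall a, a \in l -> a = 0) \/
  exists g, [/\ rational_in kappa w g, {in l, forall a, exists P, g * a = ev P} &
    forall J : K -> Prop, (forall a b, J a -> J b -> J (a + b)) ->
      (forall a P, J a -> J (ev P * a)) -> {in l, forall a, J (g * a)} -> J 1].
Proof.
have EF := rational_subfield kappa w.
elim: l => [|x l IHl] rl; first by left.
have rx : rational_in kappa w x by apply: rl; rewrite mem_head.
case: IHl => [a al_|l0|[g [rg gP gJ]]]; first by apply: rl; rewrite inE al_ orbT.
- have [->|nzx] := eqVneq x 0.
    by left=> a; rewrite inE => /orP[/eqP//|/l0].
  right; exists x^-1; split=> [|a|J JD JM Jl]; first exact: (subV EF).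
    rewrite inE => /orP[/eqP->|/l0->]; first by exists 1; rewrite mulVf // rmorph1.
    by exists 0; rewrite mulr0 rmorph0.
  by rewrite -(mulVf nzx); apply: Jl; rewrite mem_head.
- right; have rgx : rational_in kappa w (g * x) by apply: (subM EF).
  have [P [Q [cPQ nzQ gxE]]] := rational_coprime tw rgx.
  have nzeQ : ev Q != 0 by rewrite ev_eq0.
  have gxQ : ev Q * g * x = ev P by rewrite -mulrA gxE mulrC divfK.
  exists (ev Q * g); split=> [|a|J JD JM Jl].
    by apply: (subM EF) => //; apply: rational_ev.
    rewrite inE => /orP[/eqP->|/gP[R RE]]; first by exists P.
    by exists (Q * R); rewrite rmorphM /= -RE mulrA.
  have [A [B AB]] := coprimep_bezout cPQ.
  have JP : J (ev P) by rewrite -gxQ; apply: Jl; rewrite mem_head.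
  have JQ : J (ev Q).
    rewrite -[ev Q]mulr1; apply: (gJ (fun a => J (ev Q * a))).
    + by move=> a b Ja Jb; rewrite mulrDr; apply: JD.
    + by move=> a R Ja; rewrite mulrCA; apply: JM.
    + by move=> a al_; rewrite mulrA; apply: Jl; rewrite inE al_ orbT.
  by rewrite -(rmorph1 ev) -AB rmorphD !rmorphM; apply: JD; apply: JM.
Qed.

(** Regularity may be tested on the two charts where [z] and where [1 / z] is
    integral. Multiply the polynomial whose roots are the conjugates of [z] by a
    rational function, so that its coefficients lie in [k[w]] and generate the unit
    ideal there, and divide it by ['X - z]. By Kronecker's lemma the
    coefficients [c] of the quotient and the products [c z] are integral, and they
    generate the unit ideal because the coefficients of the dividend are sums of
    them. The first chart contains the locus [c != 0], the second [c z != 0]. *)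
Lemma codifferent_cover z h :
  (forall e, int e -> int (e * z) -> codifferent_away e h) ->
  (forall e, int e -> int (e / z) -> codifferent_away e h) -> codifferent h.
Proof.
move=> h1 h2.
pose q : {poly K} := ('X - (al z)%:P) * ('X - (be z)%:P) * ('X - (al (be z))%:P).
pose p := q * ('X - z%:P).
have rp : {in (p : seq K), forall a, rational_in kappa w a}.
  (* [p] has the conjugates of [z] as its roots, so it is Galois invariant. *)
  have alp : map_poly al p = p.
    rewrite /p /q !rmorphM !rmorphB /= !map_polyX !map_polyC /= !alK; ring.
  have bep : map_poly be p = p.
    rewrite /p /q !rmorphM !rmorphB /= !map_polyX !map_polyC /= -!al_be !beK; ring.
  move=> _ /(nthP 0)[j _ <-]; apply: fixedE; first by rewrite -{2}alp coef_map.
  by rewrite -{2}bep coef_map.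
have mp : p \is monic by rewrite !monicMr ?monicXsubC.
have [p0|[g [_ gP gJ]]] := content_normalization rp.
  have /p0/eqP : lead_coef p \in (p : seq K).
    by rewrite lead_coefE mem_nth // prednK ?leqnn // size_poly_gt0 monic_neq0.
  by rewrite (monicP mp) oner_eq0.
have igq j : int (g *: q)`_j /\ int ((g *: q)`_j * z).
  apply: kronecker_quotient => {}j; rewrite -scalerAl coefZ.
  have [lt_j|le_j] := ltnP j (size p).
    by have [P ->] := gP p`_j (mem_nth _ lt_j); apply: integral_id.
  by rewrite -/p nth_default // mulr0; apply: integral0.
(* [J] is the radical of the ideal of the denominators of [h]. *)
pose J e := int e /\ codifferent_away e h.
have JM a P : J a -> J (ev P * a).
  move=> [ia [n cn]]; split; first by apply: integral_mul => //; apply: integral_id.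
  exists n; rewrite exprMn -mulrA; apply: codifferentM => //.
  by apply: integral_exp; apply: integral_id.
have JD a b : J a -> J b -> J (a + b).
  move=> [ia [m cm]] [ib [n cn]]; split; first exact: integral_add.
  exists (m + n)%N; rewrite exprDn mulr_suml.
  apply: (big_ind codifferent); [exact: codifferent0|exact: codifferentD|move=> j _].
  rewrite mulrnAl -mulr_natl -(rmorph_nat kappa).
  apply: codifferentM; last exact: integral_const.
  have [le_jn|lt_nj] := leqP j n.
    have -> : a ^+ (m + n - j) * b ^+ j * h = (a ^+ (n - j) * b ^+ j) * (a ^+ m * h).
      by rewrite -addnBA // exprD; ring.
    by apply: codifferentM => //; apply: integral_mul; apply: integral_exp.
  have -> : a ^+ (m + n - j) * b ^+ j * h
      = (a ^+ (m + n - j) * b ^+ (j - n)) * (b ^+ n * h).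
    by rewrite -[in LHS](subnK (ltnW lt_nj)) exprD (subnK (ltnW lt_nj)); ring.
  by apply: codifferentM => //; apply: integral_mul; apply: integral_exp.
have [_ [n]] : J 1.
  apply: (gJ J JD JM) => _ /(nthP 0)[j _ <-].
  rewrite -coefZ scalerAl coef_mulXsubC.
  have Jq i : J (g *: q)`_i.
    by have [iq iqz] := igq i; split=> //; apply: h1.
  have Jqz i : J ((g *: q)`_i * z).
    have [iq iqz] := igq i; split=> //; apply: h2 => //.
    have [->|nzz] := eqVneq z 0; first by rewrite mulr0 mul0r; apply: integral0.
    by rewrite mulfK.
  have JN a : J a -> J (- a).
    move=> Ja; have := JM _ (-1) Ja; rewrite rmorphN rmorph1 mulN1r; exact.
  apply: JD; last exact: JN.
  case: j => [|j]; last exact: Jq.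
  by split; [exact: integral0 | exists 1; rewrite mul0r; exact: codifferent0].
by rewrite expr1n mul1r.
Qed.

(** A differential that is regular on the two affine charts [u = z] and
    [u = 1/z] has a trace that is regular at every finite value of [w]. *)
Lemma trace_form_regular z S P P' j j' d : z != 0 -> S != 0 ->
  separable_poly P -> separable_poly P' ->
  S ^+ 2 = evaluate z P -> (S / z ^+ d) ^+ 2 = evaluate z^-1 P' ->
  (j + j' + 2 = d)%N -> exists Q, Tr (z ^+ j * D z / S) = ev Q.
Proof.
move=> nzz nzS sepP sepP' S2 S2' dE.
have ch : codifferent (z ^+ j * D z / S).
  apply: codifferent_cover => e ie iez.
    have iz : integral_away e z by exists 1%N; rewrite expr1; exact: iez.
    exact: codifferent_away_form sepP nzS S2 iz.
  have -> : z ^+ j * D z / S = evaluate z (-1) * (z^-1 ^+ j' * D z^-1 / (S / z ^+ d)).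
    rewrite rmorphN rmorph1 (derV DD) -dE !exprD exprVn; field.
    by rewrite ?nzS ?nzz ?expf_neq0.
  apply: codifferent_awayM.
    by rewrite rmorphN rmorph1; apply/away_integral/integral_opp/integral1.
  have iz : integral_away e z^-1 by exists 1%N; rewrite expr1; exact: iez.
  apply: codifferent_away_form ie _ _ _ _ sepP' _ S2' iz.
  by rewrite mulf_neq0 // invr_eq0 expf_neq0.
have [Q QE] := ch 1 (integral1 _); exists Q.
by rewrite -QE mulr1.
Qed.

End TraceForm.

(** * Binary forms *)

Section Homogenization.
Variables (k : fieldType) (A B : {poly k}) (e : nat).
Implicit Types C D : {poly k}.

Definition homogenize C := \sum_(j < e.+1) C`_j *: (A ^+ j * B ^+ (e - j)).

Lemma ev_homogenize (K : fieldType) (kappa : {rmorphism k -> K}) w C :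
  (size C <= e.+1)%N -> ev kappa w B != 0 ->
  ev kappa w (homogenize C) = ev kappa (ev kappa w A / ev kappa w B) C * ev kappa w B ^+ e.
Proof.
move=> szC nzB; rewrite rmorph_sum [X in X * _]evE /=.
rewrite (@horner_coef_wide _ e.+1); last by rewrite size_map_poly.
rewrite mulr_suml; apply: eq_bigr => j _; rewrite evZ rmorphM !rmorphXn coef_map /=.
rewrite (exprD_split (ev kappa w B) (ltn_ord j)) expr_div_n; field.
by rewrite expf_neq0.
Qed.

Lemma homogenize_mod_r C : B %| homogenize C - C`_e *: A ^+ e.
Proof.
rewrite /homogenize big_ord_recr /= subnn expr0 mulr1 addrK.
apply: (big_ind (fun r => B %| r)); [exact: dvdp0|by move=> *; apply: dvdp_add|move=> j _].
rewrite -mul_polyC; do 2!apply: dvdp_mull.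
by have := ltn_ord j; rewrite -subn_gt0; case: (e - j)%N => // d _; rewrite exprS dvdp_mulr.
Qed.

Lemma homogenize_mod_l C : A %| homogenize C - C`_0 *: B ^+ e.
Proof.
rewrite /homogenize big_ord_recl /= subn0 expr0 mul1r addrAC subrr add0r.
apply: (big_ind (fun r => A %| r)); [exact: dvdp0|by move=> *; apply: dvdp_add|move=> j _].
by rewrite -mul_polyC; apply: dvdp_mull; apply: dvdp_mulr; rewrite exprS dvdp_mulr.
Qed.

Lemma size_lin (a b : k) : (size (a *: 'X - b%:P)%R <= 2)%N.
Proof.
rewrite (leq_trans (size_polyD _ _)) // geq_max size_polyN (leq_trans (size_polyC_leq1 _)) //.
by rewrite (leq_trans (size_scale_leq _ _)) // size_polyX.
Qed.

Lemma lin_neq0 (a b : k) : (a != 0) || (b != 0) -> a *: 'X - b%:P != 0.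
Proof.
apply: contraTneq => lin0.
have: (a *: 'X - b%:P)`_1 = 0 by rewrite lin0 coef0.
have: (a *: 'X - b%:P)`_0 = 0 by rewrite lin0 coef0.
rewrite !coefB !coefZ !coefX !coefC /= mulr1 subr0 mulr0 sub0r.
by move=> /eqP; rewrite oppr_eq0 => /eqP -> ->; rewrite eqxx.
Qed.

(** If [z = A / B] and [w = C(z) / D(z)], clearing denominators gives the
    hypothesis [w D(A, B) = C(A, B)]. Modulo [B] both forms reduce to their terms
    in [A ^+ e], so [B] divides the linear polynomial [D_e X - C_e]; likewise [A]
    divides [D_0 X - C_0]. *)
Lemma homogenize_degree C D : coprimep A B -> coprimep C D ->
  (C`_e != 0) || (D`_e != 0) ->
  'X * homogenize D = homogenize C -> (size A <= 2)%N /\ (size B <= 2)%N.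
Proof.
move=> cAB cCD nze XDC; split.
- have nz0 : (D`_0 != 0) || (C`_0 != 0).
    rewrite -negb_and; apply: contraL cCD => /andP[/eqP D0 /eqP C0].
    apply/negP => /coprimep_bezout[U [V]] /(congr1 (fun p : {poly k} => p`_0)).
    by rewrite coefD !coef0M D0 C0 !mulr0 addr0 coef1 => /eqP; rewrite eq_sym oner_eq0.
  apply: leq_trans (size_lin D`_0 C`_0); apply: dvdp_leq; first exact: lin_neq0.
  have : A %| (D`_0 *: 'X - (C`_0)%:P) * B ^+ e.
    have := dvdp_sub (homogenize_mod_l C) (dvdp_mull 'X (homogenize_mod_l D)).
    rewrite mulrBr XDC; congr (_ %| _); rewrite -!mul_polyC; ring.
  by rewrite mulrC Gauss_dvdpr // coprimep_expr.
- apply: leq_trans (size_lin D`_e C`_e); apply: dvdp_leq.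
    by apply: lin_neq0; rewrite orbC.
  have : B %| (D`_e *: 'X - (C`_e)%:P) * A ^+ e.
    have := dvdp_sub (homogenize_mod_r C) (dvdp_mull 'X (homogenize_mod_r D)).
    rewrite mulrBr XDC; congr (_ %| _); rewrite -!mul_polyC; ring.
  by rewrite mulrC Gauss_dvdpr // coprimep_expr // coprimep_sym.
Qed.

End Homogenization.

Lemma size_mul_leq (R : nzRingType) (p q : {poly R}) a b :
  (size p <= a.+1)%N -> (size q <= b.+1)%N -> (size (p * q)%R <= (a + b).+1)%N.
Proof. by move=> sp sq; have := size_polyMleq p q; lia. Qed.

Lemma size_binary_form (k : fieldType) (A B : {poly k}) n (d : k) :
  (size A <= 2)%N -> (size B <= 2)%N -> (size (A * B * (A ^+ n + d *: B ^+ n))%R <= n.+3)%N.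
Proof.
move=> szA szB; have szX (F : {poly k}) : (size F <= 2)%N -> (size (F ^+ n) <= n.+1)%N.
  move=> szF; rewrite (leq_trans (size_poly_exp_leq _ _)) // ltnS -{2}[n]mul1n.
  by rewrite leq_mul2r orbC; move: szF; case: (size F) => [|[|[|]]].
have szAB := @size_mul_leq _ A B 1 1 szA szB.
apply: (@size_mul_leq _ (A * B) _ 2 n szAB).
rewrite (leq_trans (size_polyD _ _)) // geq_max szX //=.
by rewrite (leq_trans (size_scale_leq _ _)) // szX.
Qed.

(** If [A] and [B] both had degree [1], one of [A ^ n + 2 B ^ n], [A ^ n - 2 B ^ n] would
    have degree [n] and its product with [A B] degree [n + 2]. If neither vanished at
    [0], both of these forms would vanish there, hence so would [B]. *)
Lemma linear_forms_monomial (k : fieldType) (A B : {poly k}) n (c1 c2 : k) (P1 P2 : {poly k}) :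
  (0 < n)%N -> 2 != 0 :> k -> (size A <= 2)%N -> (size B <= 2)%N ->
  (size P1 <= n.+2)%N -> (size P2 <= n.+2)%N -> P1`_0 = 0 -> P2`_0 = 0 ->
  A * B * (A ^+ n + 2 *: B ^+ n) = c1 *: P1 ->
  A * B * (A ^+ n - 2 *: B ^+ n) = c2 *: P2 ->
  A`_1 * B`_1 = 0 /\ A`_0 * B`_0 = 0.
Proof.
move=> n0 nz2 szA szB sP1 sP2 P10 P20 E1 E2.
split.
- apply/eqP; apply: contraT; rewrite mulf_eq0 negb_or => /andP[nzA nzB].
  have size2 (F : {poly k}) : (size F <= 2)%N -> F`_1 != 0 -> size F = 2%N.
    move=> szF nzF; apply/eqP; rewrite eqn_leq szF ltnNge.
    by apply: contraNN nzF => szF1; rewrite nth_default.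
  have szA2 := size2 _ szA nzA; have szB2 := size2 _ szB nzB.
  have nzpA : A != 0 by rewrite -size_poly_eq0 szA2.
  have nzpB : B != 0 by rewrite -size_poly_eq0 szB2.
  have small F c (P : {poly k}) : (size P <= n.+2)%N -> A * B * F = c *: P -> (size F <= n)%N.
    move=> szP AE; have [->|nzF] := eqVneq F 0; first by rewrite size_poly0.
    have := leq_trans (size_scale_leq c P) szP.
    by rewrite -AE size_mul ?mulf_neq0 // size_mul // szA2 szB2.
  have sF1 := small _ _ _ sP1 E1; have sF2 := small _ _ _ sP2 E2.
  have szAn : size (A ^+ n) = n.+1.
    rewrite -[LHS]prednK; last by rewrite size_poly_gt0 expf_neq0.
    by rewrite size_exp szA2 mul1n.
  have : (size (2 *: A ^+ n) <= n)%N.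
    have -> : 2 *: A ^+ n = (A ^+ n + 2 *: B ^+ n) + (A ^+ n - 2 *: B ^+ n).
      by rewrite -!mul_polyC (_ : 2%:P = 2) ?rmorph_nat //; ring.
    by rewrite (leq_trans (size_polyD _ _)) // geq_max sF1.
  by rewrite size_scale // szAn ltnn.
- have ev0 c (P : {poly k}) (F : {poly k}) : P`_0 = 0 -> A * B * F = c *: P ->
      A`_0 * B`_0 * F.[0] = 0.
    by move=> P0 /(congr1 (horner^~ 0)); rewrite hornerZ !hornerM !horner_coef0 P0 mulr0.
  apply/eqP; apply: contraT => nzAB; have := ev0 _ _ _ P10 E1; have := ev0 _ _ _ P20 E2.
  move=> /eqP; rewrite mulf_eq0 (negPf nzAB) => /eqP F2.
  move=> /eqP; rewrite mulf_eq0 (negPf nzAB) => /eqP F1.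
  move: nzAB; rewrite mulf_eq0 negb_or => /andP[_ /negP[]].
  have : 2 * 2 * B`_0 ^+ n = 0.
    move: F1 F2; rewrite !(hornerD, hornerN, hornerZ, horner_exp) !horner_coef0 => F1 F2.
    transitivity ((A`_0 ^+ n + 2 * B`_0 ^+ n) - (A`_0 ^+ n - 2 * B`_0 ^+ n)); first by ring.
    by rewrite F1 F2 subrr.
  by move/eqP; rewrite !mulf_eq0 (negPf nz2) expf_eq0 n0.
Qed.

(** * Automorphisms preserve the field of rational functions of w *)

Lemma separable_binomial (k : fieldType) (c d : k) n : n%:R != 0 :> k ->
  c != 0 -> d != 0 -> separable_poly (c *: 'X^n + d%:P).
Proof.
move=> nzn nzc nzd; rewrite unlock; apply/Bezout_coprimepP.
exists (n%:R%:P, - 'X) => /=; rewrite -size_poly_eq1.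
have -> : n%:R%:P * (c *: 'X^n + d%:P) + - 'X * (c *: 'X^n + d%:P)^`() = (n%:R * d)%:P.
  case: n nzn => [|n] nzn; first by rewrite eqxx in nzn.
  rewrite derivD derivC addr0 derivZ derivXn /= -!mul_polyC exprS -[n.+1%:R]/(1 *+ n.+1).
  rewrite polyCM !polyCMn -mulr_natr; ring.
by rewrite size_polyC mulf_neq0.
Qed.

Lemma separable_twisted (k : fieldType) (c d : k) n : n%:R != 0 :> k ->
  c != 0 -> d != 0 -> separable_poly (c *: 'X^(n.+1) + d *: 'X).
Proof.
move=> nzn nzc nzd.
have -> : c *: 'X^(n.+1) + d *: 'X = 'X * (c *: 'X^n + d%:P).
  by rewrite exprS -!mul_polyC; ring.
rewrite separable_mul separable_binomial //=; apply/andP; split.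
  by rewrite unlock derivX coprimep1.
rewrite coprimep_sym -[X in coprimep _ X]subr0 -polyC0 coprimep_XsubC rootE !hornerE.
by case: n nzn => [|n]; rewrite ?eqxx // => _; rewrite exprS mul0r mulr0 add0r.
Qed.

Lemma size_gt_coef (k : fieldType) (P : {poly k}) j :
  P`_(j.+1) != 0 -> (1 < size P)%N.
Proof.
by apply: contra_neqT; rewrite -leqNgt => szP; apply: nth_default; apply: leq_trans szP _.
Qed.

Lemma ev_inv (k K : fieldType) (kappa : {rmorphism k -> K}) (w : K) (P : {poly k}) :
  w != 0 ->
  exists d (Q : {poly k}), (size Q <= d.+1)%N /\ w ^+ d * ev kappa w^-1 P = ev kappa w Q.
Proof.
move=> nzw; elim/poly_ind: P => [|P c [d [Q [szQ QE]]]].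
  by exists 0, 0; rewrite size_poly0 !rmorph0 mulr0.
exists d.+1, (Q + c *: 'X^(d.+1)); split.
  rewrite (leq_trans (size_polyD _ _)) // geq_max (leq_trans szQ) //=.
  by rewrite (leq_trans (size_scale_leq _ _)) // size_polyXn.
rewrite !rmorphD rmorphM /= !evX evC evZ evXn -QE !exprS; field.
by [].
Qed.

Lemma exponent_split j d : (j + 2 <= d)%N -> (j + (d - 2 - j) + 2 = d)%N.
Proof. by lia. Qed.

Lemma size_parity a b c n : (0 < a)%N -> (0 < b)%N -> b.-1 = (a.-1 * 2)%N ->
  (n.+2 <= c)%N -> ((b + c).-1 <= n.+3)%N -> a = 1%N.
Proof. by lia. Qed.

Section Vandermonde.
Variable K : fieldType.

(** The coefficients of [('X - z2) ('X - z3) ('X - z4)] combine the four power sums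
    into one multiple of [c1]. *)
Lemma vandermonde_four (z1 z2 z3 z4 c1 c2 c3 c4 : K) :
  (forall j, (j < 4)%N ->
     c1 * z1 ^+ j + c2 * z2 ^+ j + c3 * z3 ^+ j + c4 * z4 ^+ j = 0) ->
  c1 != 0 -> [\/ z1 = z2, z1 = z3 | z1 = z4].
Proof.
move=> eqs nzc.
have e0 := eqs 0 isT; have e1 := eqs 1%N isT; have e2 := eqs 2 isT; have e3 := eqs 3 isT.
have: c1 * ((z1 - z2) * (z1 - z3) * (z1 - z4)) = 0.
  transitivity
    ((c1 * z1 ^+ 3 + c2 * z2 ^+ 3 + c3 * z3 ^+ 3 + c4 * z4 ^+ 3)
     - (z2 + z3 + z4) * (c1 * z1 ^+ 2 + c2 * z2 ^+ 2 + c3 * z3 ^+ 2 + c4 * z4 ^+ 2)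
     + (z2 * z3 + z2 * z4 + z3 * z4)
       * (c1 * z1 ^+ 1 + c2 * z2 ^+ 1 + c3 * z3 ^+ 1 + c4 * z4 ^+ 1)
     - (z2 * z3 * z4) * (c1 * z1 ^+ 0 + c2 * z2 ^+ 0 + c3 * z3 ^+ 0 + c4 * z4 ^+ 0)).
    ring.
  by rewrite e0 e1 e2 e3; ring.
move/eqP; rewrite !mulf_eq0 (negPf nzc) !subr_eq0 /= -orbA.
by case/or3P => /eqP; [constructor 1 | constructor 2 | constructor 3].
Qed.

Lemma vandermonde_two (z z' c c' : K) : c + c' = 0 -> c * z + c' * z' = 0 ->
  z != z' -> c = 0.
Proof.
move=> /eqP; rewrite addr_eq0 => /eqP-> /eqP; rewrite mulNr addrC -mulrBr mulf_eq0.
rewrite subr_eq0 => /orP[/eqP->|/eqP-> /eqP//]; by rewrite oppr0.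
Qed.

End Vandermonde.

(** The biquadratic model [s ^ 2 = w ^ (n + 1) + 2 w], [t ^ 2 = w ^ (n + 1) - 2 w];
    here [(s t / w) ^ 2 = w ^ (2 n) - 4]. *)
Section Curve.
Variables (k : closedFieldType) (K : fieldType) (kappa : {rmorphism k -> K}).
Variables (n nu : nat) (w s t : K).
Hypotheses (nE : n = nu.*2) (nu_ge3 : (2 < nu)%N).
Hypotheses (nz2 : 2 != 0 :> k) (nzn : n%:R != 0 :> k).
Hypotheses (tw : transcendental kappa w) (s2 : s ^+ 2 = w ^+ n.+1 + 2 * w)
  (t2 : t ^+ 2 = w ^+ n.+1 - 2 * w).
Notation ratw := (rational_in kappa w).
Hypothesis genK : forall z, adjoin (adjoin ratw s) t z.
Notation ev := (ev kappa).

Let nz2K : 2 != 0 :> K. Proof. by rewrite -(rmorph_nat kappa) fmorph_eq0. Qed.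
Let nz4 : 4 != 0 :> k. Proof. by rewrite (_ : 4 = 2 * 2) ?mulf_neq0 // -natrM. Qed.
Let nz2n : (n.*2)%:R != 0 :> k.
Proof. by rewrite -muln2 natrM mulf_neq0. Qed.

(* The primed polynomials are the same right-hand sides seen from infinity:
   they give the squares of [s], [t] and [s t / w], divided by a suitable power of
   [w], as polynomials in [1 / w]. *)
Let ps : {poly k} := 1 *: 'X^(n.+1) + 2 *: 'X.
Let pt : {poly k} := 1 *: 'X^(n.+1) + (- 2) *: 'X.
Let pv : {poly k} := 1 *: 'X^(n.*2) + (- 4)%:P.
Let ps' : {poly k} := 2 *: 'X^(n.+1) + 1 *: 'X.
Let pt' : {poly k} := (- 2) *: 'X^(n.+1) + 1 *: 'X.
Let pv' : {poly k} := (- 4) *: 'X^(n.*2) + 1%:P.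

Let sep_ps : separable_poly ps. Proof. by apply: separable_twisted; rewrite ?oner_neq0. Qed.
Let sep_pt : separable_poly pt.
Proof. by apply: separable_twisted; rewrite ?oner_neq0 ?oppr_eq0. Qed.
Let sep_pv : separable_poly pv.
Proof. by apply: separable_binomial; rewrite ?oner_neq0 ?oppr_eq0. Qed.
Let sep_ps' : separable_poly ps'. Proof. by apply: separable_twisted; rewrite ?oner_neq0. Qed.
Let sep_pt' : separable_poly pt'.
Proof. by apply: separable_twisted; rewrite ?oner_neq0 ?oppr_eq0. Qed.
Let sep_pv' : separable_poly pv'.
Proof. by apply: separable_binomial; rewrite ?oner_neq0 ?oppr_eq0. Qed.

Let ev_ps z : ev z ps = z ^+ n.+1 + 2 * z.
Proof. by rewrite rmorphD /= !evZ evXn evX rmorph1 mul1r rmorph_nat. Qed.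
Let ev_pt z : ev z pt = z ^+ n.+1 - 2 * z.
Proof. by rewrite rmorphD /= !evZ evXn evX rmorph1 mul1r rmorphN rmorph_nat mulNr. Qed.
Let ev_pv z : ev z pv = z ^+ n.*2 - 4.
Proof. by rewrite rmorphD /= !evZ evXn evC rmorph1 mul1r rmorphN rmorph_nat. Qed.
Let ev_ps' z : ev z ps' = 2 * z ^+ n.+1 + z.
Proof. by rewrite rmorphD /= !evZ evXn evX rmorph1 mul1r rmorph_nat. Qed.
Let ev_pt' z : ev z pt' = - (2 * z ^+ n.+1) + z.
Proof. by rewrite rmorphD /= !evZ evXn evX rmorph1 mul1r rmorphN rmorph_nat mulNr. Qed.
Let ev_pv' z : ev z pv' = - (4 * z ^+ n.*2) + 1.
Proof. by rewrite rmorphD /= !evZ evXn evC !rmorph1 rmorphN rmorph_nat mulNr. Qed.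

Let EF0 := rational_subfield kappa w.

(** Such a root is integral over [k[w]], so it is a polynomial whose square is [P]. *)
Lemma square_free_sqrt_irrational (z : K) (P : {poly k}) : separable_poly P -> (1 < size P)%N ->
  z ^+ 2 = ev w P -> ~ ratw z.
Proof.
move=> sepP szP z2 rz.
have [|Q zE] := integral_rational tw _ rz.
  by apply: integral_sqrt; rewrite z2; apply: integral_id.
have : Q ^+ 2 %| P.
  suff -> : P = Q ^+ 2 by [].
  by apply: (ev_inj tw); rewrite -z2 zE rmorphXn.
have [/eqP/size_poly1P[c nzc QE] _|szQ] := eqVneq (size Q) 1%N; last first.
  by rewrite separable_nosquare.
have PE : P = (c ^+ 2)%:P.
  by apply: (ev_inj tw); rewrite -z2 zE QE !evC rmorphXn.
by move: szP; rewrite PE ltnNge size_polyC_leq1.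
Qed.

Let nzw : w != 0. Proof. exact: transcendental_neq0 tw. Qed.

Let st2 : (s * t / w) ^+ 2 = w ^+ n.*2 - 4.
Proof.
rewrite expr_div_n exprMn s2 t2 !exprS -mul2n mulnC exprM.
by field.
Qed.

Let n_gt0 : (0 < n)%N. Proof. by rewrite nE double_gt0; apply: leq_trans nu_ge3. Qed.
Let ngt1 : (n.+1 == 1)%N = false. Proof. by rewrite eqSS gtn_eqF. Qed.

Let s_irr : ~ ratw s.
Proof.
apply: (@square_free_sqrt_irrational s ps sep_ps); last by rewrite ev_ps.
by apply: (@size_gt_coef _ _ n);
    rewrite coefD !coefZ coefXn coefX eqxx ngt1 mulr0 addr0 mulr1 oner_neq0.
Qed.

Let t_irr : ~ adjoin ratw s t.
Proof.
move=> [a [b [ra rb tE]]].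
have EF := EF0; have rw : ratw w by apply: rational_gen.
have r2 : ratw 2 by rewrite -(rmorph_nat kappa); apply: rational_const.
have rs2 : ratw (s ^+ 2) by rewrite s2; insub EF.
have rt2 : ratw (t ^+ 2) by rewrite t2; insub EF.
have [b0|nzb] := eqVneq b 0.
  apply: (@square_free_sqrt_irrational t pt sep_pt).
    by apply: (@size_gt_coef _ _ n);
    rewrite coefD !coefZ coefXn coefX eqxx ngt1 mulr0 addr0 mulr1 oner_neq0.
    by rewrite ev_pt.
  by rewrite tE b0 mul0r addr0.
have [a0|nza] := eqVneq a 0.
  apply: (@square_free_sqrt_irrational (s * t / w) pv sep_pv).
    apply: (@size_gt_coef _ _ (n.*2).-1).
    rewrite coefD coefZ coefXn coefC prednK ?eqxx ?double_gt0 //.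
    by rewrite gtn_eqF ?double_gt0 // addr0 mulr1 oner_neq0.
    by rewrite ev_pv st2.
  have -> : s * t / w = s ^+ 2 * b / w by rewrite tE a0; ring.
  by insub EF.
apply: s_irr.
have -> : s = (t ^+ 2 - a ^+ 2 - b ^+ 2 * s ^+ 2) / (2 * a * b).
  by rewrite tE; field; rewrite ?nza ?nzb ?nz2K.
by insub EF.
Qed.

Let nzs : s != 0. Proof. by apply/eqP => s0; apply: s_irr; rewrite s0; apply: (sub0 EF0). Qed.
Let nzt : t != 0.
Proof.
apply/eqP => t0; apply: t_irr; rewrite t0; apply: adjoin_sub => //; apply: (sub0 EF0).
Qed.

Let neq_opp (u : K) : u != 0 -> u <> - u.
Proof.
move=> nzu /eqP; rewrite -addr_eq0 -mulr2n -mulr_natl mulf_eq0 (negPf nz2K).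
by rewrite (negPf nzu).
Qed.

Lemma curve_hom W S T : transcendental kappa W ->
  S ^+ 2 = W ^+ n.+1 + 2 * W -> T ^+ 2 = W ^+ n.+1 - 2 * W ->
  exists f : {rmorphism K -> K},
    [/\ forall c, f (kappa c) = kappa c, f w = W, f s = S & f t = T].
Proof.
move=> tW S2 T2; apply: (@biquadratic_hom _ _ kappa w s t ps pt) => //.
- by rewrite s2 ev_ps.
- by rewrite t2 ev_pt.
- by rewrite S2 ev_ps.
- by rewrite T2 ev_pt.
Qed.

Lemma curve_hom_eq (f g : {rmorphism K -> K}) :
  (forall c, f (kappa c) = kappa c) -> (forall c, g (kappa c) = kappa c) ->
  f w = g w -> f s = g s -> f t = g t -> f =1 g.
Proof.
move=> fc gc; apply: (@biquadratic_hom_eq _ _ kappa w s t) => // c.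
by rewrite fc gc.
Qed.

Lemma klein_group : exists al be : {rmorphism K -> K},
  [/\ [/\ forall c, al (kappa c) = kappa c, al w = w, al s = - s & al t = t],
      [/\ forall c, be (kappa c) = kappa c, be w = w, be s = s & be t = - t],
      involutive al, involutive be & forall z, al (be z) = be (al z)].
Proof.
have [|al [alc alw als alt]] := @curve_hom w (- s) t tw _ t2; first by rewrite sqrrN.
have [|be [bec bew bes bet]] := @curve_hom w s (- t) tw s2 _; first by rewrite sqrrN.
exists al, be; split=> // z.
- have := @curve_hom_eq (al \o al : {rmorphism K -> K}) idfun; apply=> [c|//| | |] /=.
  + by rewrite !alc.
  + by rewrite !alw.
  + by rewrite als rmorphN /= als opprK.
  + by rewrite !alt.
- have := @curve_hom_eq (be \o be : {rmorphism K -> K}) idfun; apply=> [c|//| | |] /=.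
  + by rewrite !bec.
  + by rewrite !bew.
  + by rewrite !bes.
  + by rewrite bet rmorphN /= bet opprK.
- have := @curve_hom_eq (al \o be : {rmorphism K -> K}) (be \o al); apply=> [c|c| | |] /=.
  + by rewrite bec !alc.
  + by rewrite alc !bec.
  + by rewrite bew !alw.
  + by rewrite bes als rmorphN /= bes.
  + by rewrite alt bet rmorphN /= alt.
Qed.

Section KleinGroup.
Variables al be : {rmorphism K -> K}.
Hypotheses (alc : forall c, al (kappa c) = kappa c) (alw : al w = w)
  (als : al s = - s) (alt : al t = t)
  (bec : forall c, be (kappa c) = kappa c) (bew : be w = w)
  (bes : be s = s) (bet : be t = - t)
  (alK : involutive al) (beK : involutive be) (al_be : forall z, al (be z) = be (al z)).
Variable D : K -> K.
Hypotheses (DD : k_derivation kappa D) (Dw : D w = 1).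
Notation Tr := (klein_trace al be).

Lemma klein_fixed z : al z = z -> be z = z -> ratw z.
Proof.
have EF := EF0; have alr a : ratw a -> al a = a /\ be a = a.
  by move=> [P [Q [_ ->]]]; rewrite !fmorph_div /= !rmorph_ev ?alw ?bew.
have /(_ _ _) double0 : forall a : K, a + a = 0 -> a = 0.
  by move=> a; rewrite -mulr2n -mulr_natl => /eqP; rewrite mulf_eq0 (negPf nz2K) => /eqP.
have [a [b [[a0 [a1 [ra0 ra1 ->]]] [b0 [b1 [rb0 rb1 ->]]] ->]]] := genK z.
have [ala0 bea0] := alr _ ra0; have [ala1 bea1] := alr _ ra1.
have [alb0 beb0] := alr _ rb0; have [alb1 beb1] := alr _ rb1.
move=> alz bez.
have {}bez : (b0 + b1 * s) * t = 0.
  apply: double0; move: bez; rewrite !rmorphD !rmorphM /= !rmorphD !rmorphM /=.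
  rewrite bea0 bea1 beb0 beb1 bes bet mulrN => /addrI bez.
  by rewrite -{1}bez addNr.
move: alz; rewrite bez addr0 rmorphD rmorphM /= ala0 ala1 als mulrN => /addrI az.
have -> : a1 * s = 0 by apply: double0; rewrite -{1}az addNr.
by rewrite addr0.
Qed.

(** The trace to the [w]-line of a regular differential is regular, hence zero. It
    is regular at finite [w], and also at infinity by the same result applied to
    [1 / w], for which the derivation is [- w ^ 2 D]; a polynomial [R] such that
    [w ^ 2 R] is a polynomial in [1 / w] vanishes. *)
Lemma trace_form_zero z S P P' j j' d : z != 0 -> S != 0 ->
  separable_poly P -> separable_poly P' ->
  S ^+ 2 = ev z P -> (S / z ^+ d) ^+ 2 = ev z^-1 P' ->
  (j + j' + 2 = d)%N -> Tr (z ^+ j * D z / S) = 0.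
Proof.
move=> nzz nzS sepP sepP' S2 S2' dE.
have nzv : s * t / w != 0 by rewrite !mulf_neq0 // invr_eq0.
have [R0 R0E] : exists R, Tr (z ^+ j * D z / S) = ev w R.
  apply: (@trace_form_regular k K kappa w tw nz2 al be alc alw bec bew alK beK al_be
    klein_fixed s t (s * t / w) ps pt pv) S2 S2' dE => //.
  - by rewrite fmorph_div rmorphM /= als alt alw !mulNr.
  - by rewrite fmorph_div rmorphM /= bes bet bew mulrN mulNr.
  - by rewrite s2 ev_ps.
  - by rewrite t2 ev_pt.
  - by rewrite st2 ev_pv.
have [R1 R1E] : exists R, Tr (z ^+ j * (- w ^+ 2 * D z) / S) = ev w^-1 R.
  have twV : transcendental kappa w^-1.
    apply: transcendental_closed => c wc.
    by apply: (transcendental_neq tw (c := c^-1)); rewrite fmorphV -wc invrK.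
  have nzwn e : w ^+ e != 0 by rewrite expf_neq0.
  apply: (@trace_form_regular k K kappa w^-1 twV nz2 al be alc _ bec _ alK beK al_be
    _ (s / w ^+ nu.+1) (t / w ^+ nu.+1) (s * t / w / w ^+ n) ps' pt' pv' _ _ _ _ _ _ _ _ _
    _ _ _ _ _ _ (fun z => - w ^+ 2 * D z)) S2 S2' dE => //.
  - by rewrite fmorphV alw.
  - by rewrite fmorphV bew.
  - move=> u fa fb; have EF := rational_subfield kappa w^-1.
    apply: (subfield_rational EF _ _ (klein_fixed fa fb)).
      exact: rational_const.
    by rewrite -{2}[w]invrK; apply: (subV (rational_subfield _ _)); apply: rational_gen.
  - by rewrite mulf_neq0 // invr_eq0.
  - by rewrite mulf_neq0 // invr_eq0.
  - by rewrite mulf_neq0 // invr_eq0.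
  - by rewrite fmorph_div rmorphXn /= als alw mulNr.
  - by rewrite fmorph_div rmorphXn /= bes bew.
  - by rewrite fmorph_div rmorphXn /= alt alw.
  - by rewrite fmorph_div rmorphXn /= bet bew mulNr.
  - by rewrite !fmorph_div rmorphM rmorphXn /= als alt alw !mulNr.
  - by rewrite !fmorph_div rmorphM rmorphXn /= bes bet bew mulrN !mulNr.
  - rewrite expr_div_n s2 ev_ps' exprVn -exprM muln2 doubleS -nE !exprS.
    by field; rewrite nzw nzwn.
  - rewrite expr_div_n t2 ev_pt' exprVn -exprM muln2 doubleS -nE !exprS.
    by field; rewrite nzw nzwn.
  - by rewrite expr_div_n st2 ev_pv' exprVn -exprM muln2; field.
  - split; first split.
    + by move=> a b _ _; rewrite (derB DD); ring.
    + by move=> a b _ _; rewrite (derM DD); ring.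
    + by move=> c; rewrite (der_const DD) mulr0.
  - by rewrite (derV DD) Dw; field.
have : - w ^+ 2 * ev w R0 = ev w^-1 R1.
  rewrite -R1E -R0E /klein_trace.
  have -> : z ^+ j * (- w ^+ 2 * D z) / S = - w ^+ 2 * (z ^+ j * D z / S) by ring.
  have fixw (f : {rmorphism K -> K}) u : f w = w -> f (- w ^+ 2 * u) = - w ^+ 2 * f u.
    by move=> fw; rewrite rmorphM rmorphN rmorphXn /= fw.
  by rewrite !fixw //; ring.
move=> eqR.
have [d1 [R2 [szR2 R2E]]] := ev_inv kappa R1 nzw.
have : - 'X^(d1.+2) * R0 = R2.
  apply: (ev_inj tw); rewrite -R2E -eqR rmorphM rmorphN /= evXn !exprS; ring.
have [R00 _|nzR0 RE] := eqVneq R0 0; first by rewrite R0E R00 rmorph0.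
move: szR2; rewrite -RE mulNr size_opp mulrC size_mulXn //.
by rewrite leqNgt !addSn !ltnS leq_addr.
Qed.

(** The images [z], [S], [T] of [w], [s], [t] under an automorphism [sg] satisfy the
    same equations, and the differentials [z ^ j dz / S], [z ^ j dz / T] and
    [z ^ j dz z / (S T)] are regular for small [j]. *)
Section Orbit.
Variable sg sgV : {rmorphism K -> K}.
Hypotheses (sgc : forall c, sg (kappa c) = kappa c) (sgK : cancel sgV sg).

Variables z S T : K.
Hypotheses (zE : sg w = z) (SE : sg s = S) (TE : sg t = T).
Notation V := (S * T / z).

Let S2 : S ^+ 2 = z ^+ n.+1 + 2 * z.
Proof. by rewrite -SE -zE -rmorphXn s2 rmorphD rmorphM rmorphXn rmorph_nat. Qed.
Let T2 : T ^+ 2 = z ^+ n.+1 - 2 * z.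
Proof. by rewrite -TE -zE -rmorphXn t2 rmorphB rmorphM rmorphXn rmorph_nat. Qed.
Let V2 : V ^+ 2 = z ^+ n.*2 - 4.
Proof.
have := congr1 sg st2; rewrite rmorphXn fmorph_div rmorphM rmorphB rmorphXn /= zE SE TE => ->.
by rewrite rmorph_nat.
Qed.
Let nzz : z != 0. Proof. by rewrite -zE fmorph_eq0. Qed.
Let nzS : S != 0. Proof. by rewrite -SE fmorph_eq0. Qed.
Let nzT : T != 0. Proof. by rewrite -TE fmorph_eq0. Qed.
Let nzV : V != 0. Proof. by rewrite !mulf_neq0 // invr_eq0. Qed.
Let nzzn e : z ^+ e != 0. Proof. by rewrite expf_neq0. Qed.

Let traceS j : (j < 2)%N -> Tr (z ^+ j * D z / S) = 0.
Proof.
move=> j2; apply: (@trace_form_zero z S ps ps' j (nu.+1 - 2 - j) nu.+1) => //.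
- by rewrite S2 ev_ps.
- rewrite expr_div_n S2 ev_ps' exprVn -exprM muln2 doubleS -nE !exprS.
  by field; rewrite nzz nzzn.
- by apply: exponent_split; rewrite addn2 ltnS (leq_trans j2) // ltnW.
Qed.

Let traceT j : (j < 2)%N -> Tr (z ^+ j * D z / T) = 0.
Proof.
move=> j2; apply: (@trace_form_zero z T pt pt' j (nu.+1 - 2 - j) nu.+1) => //.
- by rewrite T2 ev_pt.
- rewrite expr_div_n T2 ev_pt' exprVn -exprM muln2 doubleS -nE !exprS.
  by field; rewrite nzz nzzn.
- by apply: exponent_split; rewrite addn2 ltnS (leq_trans j2) // ltnW.
Qed.

Let traceV j : (j < 4)%N -> Tr (z ^+ j * D z / V) = 0.
Proof.
move=> j4; apply: (@trace_form_zero z V pv pv' j (n - 2 - j) n) => //.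
- by rewrite V2 ev_pv.
- by rewrite expr_div_n V2 ev_pv' exprVn -exprM muln2; field.
- apply: exponent_split; rewrite nE (leq_trans _ (_ : 3.*2 <= nu.*2)%N) ?leq_double //.
  by rewrite addn2 !ltnS ltnW.
Qed.

(* Otherwise the conjugate of [D] by [sg] kills [w], hence is zero. *)
Let Dz_neq0 : D z != 0.
Proof.
apply/eqP => Dz0; pose D' u := sgV (D (sg u)).
have DD' : k_derivation kappa D'.
  have sgVc c : sgV (kappa c) = kappa c.
    by apply: (fmorph_inj sg); rewrite sgK sgc.
  have sgVK : cancel sg sgV by move=> u; apply: (fmorph_inj sg); rewrite sgK.
  split; first split.
  - by move=> a b _ _; rewrite /D' rmorphB (derB DD) rmorphB.
  - by move=> a b _ _; rewrite /D' rmorphM (derM DD) rmorphD !rmorphM /= !sgVK.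
  - by move=> c; rewrite /D' sgc (der_const DD) rmorph0.
have D0 : k_derivation kappa (fun=> 0).
  by split; first split; move=> *; rewrite ?subrr ?mul0r ?mulr0 ?addr0.
have D'w : D' w = 0 by rewrite /D' zE Dz0 rmorph0.
have := @biquadratic_derivation_eq k K kappa w s t ps pt _ _ nz2K s_irr t_irr genK D' _ DD' D0 D'w.
rewrite s2 t2 ev_ps ev_pt => /(_ erefl erefl (sgV w)).
by rewrite /D' sgK Dw rmorph1 => /eqP; rewrite oner_eq0.
Qed.

(* An element of the Klein group that fixes [z] multiplies [S], [T] and [V] by
   signs of product [1]. If the orbit of [z] has two elements, the vanishing traces
   force the three signs to be equal, so they are [1], and [f] fixes the generators
   [z], [S], [T] of [K]. *)
Let no_half_orbit (f g : {rmorphism K -> K}) :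
  (forall u, Tr u = klein_trace f g u) -> (exists u, f u != u) ->
  (forall u, f (g u) = g (f u)) -> (forall c, f (kappa c) = kappa c) ->
  f z = z -> g z = z.
Proof.
move=> TrE [u nfix] fg fc fz; apply/eqP; apply: contraT => gz; case/negP: nfix; apply/eqP.
have half Y : (forall j, (j < 2)%N -> Tr (z ^+ j * D z / Y) = 0) ->
    D z / Y + f (D z / Y) = 0.
  move=> trY; have := trY 0 isT; have := trY 1%N isT.
  rewrite expr1 expr0 mul1r -mulrA; move: (D z / Y) => q.
  rewrite !TrE /klein_trace !rmorphM /= fz fg fz => e1 e0.
  apply: (@vandermonde_two _ z (g z) _ (g q + f (g q))).
  - by rewrite addrA e0.
  - by rewrite -e1; ring.
  - by rewrite eq_sym.
have fp P : f (z ^+ P) = z ^+ P by rewrite rmorphXn /= fz.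
have fS : f (S ^+ 2) = S ^+ 2 by rewrite S2 rmorphD rmorphM rmorph_nat /= fp fz.
have fT : f (T ^+ 2) = T ^+ 2 by rewrite T2 rmorphB rmorphM rmorph_nat /= fp fz.
have hS := half S traceS; have hT := half T traceT.
have hV : D z / V + f (D z / V) = 0.
  by apply: half => j j2; apply: traceV; apply: leq_trans j2 _.
have nzf : f (D z) != 0 by rewrite fmorph_eq0.
have sgn Y : Y != 0 -> f (Y ^+ 2) = Y ^+ 2 -> D z / Y + f (D z / Y) = 0 ->
    (f Y = Y /\ f (D z) = - D z) \/ (f Y = - Y /\ f (D z) = D z).
  move=> nzY /eqP; rewrite rmorphXn eqf_sqr fmorph_div => /orP[]/eqP-> /eqP.
    by rewrite -mulrDl mulf_eq0 invr_eq0 (negPf nzY) orbF addrC addr_eq0 => /eqP->; left.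
  rewrite invrN mulrN -mulrBl mulf_eq0 invr_eq0 (negPf nzY) orbF subr_eq0 => /eqP<-.
  by right.
have fV : f V = f S * f T / z by rewrite fmorph_div rmorphM /= fz.
have fDz : f (D z) = - D z /\ f S = S /\ f T = T.
  case: (sgn S nzS fS hS) => -[fS' fD]; case: (sgn T nzT fT hT) => -[fT' fD'] //.
  - by case: (neq_opp Dz_neq0); rewrite -fD.
  - by case: (neq_opp Dz_neq0); rewrite -fD'.
  - case: (neq_opp Dz_neq0); move: hV; rewrite fmorph_div fV fS' fT' mulrNN fD.
    move/eqP; rewrite -mulrDl mulf_eq0 invr_eq0 (negPf nzV) orbF addr_eq0.
    by move/eqP.
have [_ [fSS fTT]] := fDz.
rewrite -(sgK u); have := @curve_hom_eq (f \o sg : {rmorphism K -> K}) sg; apply=> //=.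
- by move=> c; rewrite sgc.
- by rewrite zE.
- by rewrite SE.
- by rewrite TE.
Qed.

(** If the orbit of [z] under the Klein group had four elements, the four traces
    against [z ^ j dz / V] would contradict the Vandermonde determinant; orbits of
    two elements are excluded by [no_half_orbit]. *)
Lemma automorphism_preserves_rational : ratw z.
Proof.
have moves (f : {rmorphism K -> K}) u : u != 0 -> f u = - u -> exists v, f v != v.
  by move=> nzu fu; exists u; rewrite fu eq_sym; apply/eqP/neq_opp.
have nzal := moves al s nzs als; have nzbe := moves be t nzt bet.
have alz_bez : al z = z -> be z = z.
  by apply: (@no_half_orbit al be).
have bez_alz : be z = z -> al z = z.
  apply: (@no_half_orbit be al) => // u.
  by rewrite /klein_trace -al_be; ring.
pose gam : {rmorphism K -> K} := (al \o be : {rmorphism K -> K}).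
have gamz_alz : gam z = z -> al z = z.
  apply: (@no_half_orbit gam al).
  - by move=> u; rewrite /klein_trace /= -al_be alK; ring.
  - by apply: (moves gam s) => //=; rewrite bes als.
  - by move=> u /=; rewrite -al_be.
  - by move=> c /=; rewrite bec alc.
have nzc : D z / V != 0 by rewrite mulf_neq0 // invr_eq0.
have [| z_al | z_be | z_gam] := @vandermonde_four _ z (al z) (be z) (al (be z))
    (D z / V) (al (D z / V)) (be (D z / V)) (al (be (D z / V))) _ nzc.
- move=> j j4; have := traceV j4; rewrite -mulrA; move: (D z / V) => c.
  by rewrite /klein_trace !rmorphM !rmorphXn /= => <-; ring.
- by apply: klein_fixed; rewrite ?alz_bez.
- by apply: klein_fixed; rewrite ?bez_alz.
- by apply: klein_fixed; rewrite ?alz_bez ?gamz_alz.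
Qed.

End Orbit.
End KleinGroup.

(** * Automorphisms act on w by Moebius transformations *)

Section Moebius.
Variables sg sgV : {rmorphism K -> K}.
Hypotheses (sgc : forall c, sg (kappa c) = kappa c) (sgVc : forall c, sgV (kappa c) = kappa c)
  (sgK : cancel sgV sg) (sgVK : cancel sg sgV).

Lemma automorphism_rational (f g : {rmorphism K -> K}) :
  (forall c, f (kappa c) = kappa c) -> cancel g f -> ratw (f w).
Proof.
move=> fc fK; have [al [be [[alc alw als alt] [bec bew bes bet] alK beK al_be]]] := klein_group.
have [||D [DD Dw]] := @biquadratic_derivation _ _ kappa w s t ps pt tw _ _ nz2K s_irr t_irr genK.
- by rewrite s2 ev_ps.
- by rewrite t2 ev_pt.
exact: (@automorphism_preserves_rational al be alc alw als alt bec bew bes bet alK beK al_be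
  D DD Dw f g fc fK (f w) (f s) (f t)).
Qed.

Let rational_pull u : ratw (sg u) -> ratw u.
Proof.
move=> ru; rewrite -(sgVK u).
apply: (@subfield_rational _ _ kappa (fun x => ratw (sgV x)) w) ru.
- have EF := EF0; split; first by rewrite rmorph1; apply: (sub1 EF).
  + by move=> a b ra rb; rewrite rmorphB; apply: (subB EF).
  + by move=> a b ra rb; rewrite rmorphM; apply: (subM EF).
  + by move=> a ra; rewrite fmorphV; apply: (subV EF).
- by move=> c; rewrite sgVc; apply: rational_const.
- exact: (automorphism_rational sgVc sgVK).
Qed.

(* The Klein group acts on [u] by signs, so [u] is an eigenvector. *)
Let square_class u : ratw (u ^+ 2) -> u != 0 -> ~ ratw u ->
  exists (P : {poly k}) b, [/\ [\/ P = ps, P = pt | P = pv], ratw b & u ^+ 2 = b ^+ 2 * ev w P].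
Proof.
move=> ru2 nzu nru.
have [al [be [[alc alw als alt] [bec bew bes bet] alK beK al_be]]] := klein_group.
have fixr (f : {rmorphism K -> K}) a : (forall c, f (kappa c) = kappa c) -> f w = w ->
    ratw a -> f a = a.
  by move=> fc fw [P [Q [_ ->]]]; rewrite !fmorph_div /= !rmorph_ev ?fw.
have sgn (f : {rmorphism K -> K}) : (forall c, f (kappa c) = kappa c) -> f w = w ->
    f u = u \/ f u = - u.
  move=> fc fw; have /eqP := fixr f _ fc fw ru2.
  by rewrite rmorphXn eqf_sqr => /orP[/eqP|/eqP]; by [left|right].
have kf v : al v = v -> be v = v -> ratw v by exact: (klein_fixed alc alw als bec bew bes bet).
have key v P : [\/ P = ps, P = pt | P = pv] -> v != 0 -> v ^+ 2 = ev w P ->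
    al (u / v) = u / v -> be (u / v) = u / v -> 
    exists (P : {poly k}) b, [/\ [\/ P = ps, P = pt | P = pv], ratw b & u ^+ 2 = b ^+ 2 * ev w P].
  move=> PP nzv vP fa fb; exists P, (u / v); split=> //; first exact: kf.
  by rewrite -vP expr_div_n divfK // expf_neq0.
have nzst : s * t / w != 0 by rewrite !mulf_neq0 // invr_eq0.
case: (sgn al alc alw) => alu; case: (sgn be bec bew) => beu.
- by case: nru; apply: kf.
- apply: (key t pt); rewrite ?t2 ?ev_pt ?fmorph_div /= ?alu ?beu ?alt ?bet
    ?mulNr ?invrN ?mulrN ?opprK //.
  by constructor 2.
- apply: (key s ps); rewrite ?s2 ?ev_ps ?fmorph_div /= ?alu ?beu ?als ?bes
    ?mulNr ?invrN ?mulrN ?opprK //.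
  by constructor 1.
- apply: (key (s * t / w) pv); rewrite ?st2 ?ev_pv //.
  + by constructor 3.
  + by rewrite !fmorph_div rmorphM /= alu als alt alw !(mulNr, invrN, mulrN) opprK.
  + by rewrite !fmorph_div rmorphM /= beu bes bet bew !(mulNr, invrN, mulrN) opprK.
Qed.

Let z := sg w.
Let z_rational : ratw z. Proof. exact: automorphism_rational sgc sgK. Qed.

Let transc_z : transcendental kappa z.
Proof.
apply: transcendental_closed => c zc.
by apply: (transcendental_neq tw (c := c)); apply: (fmorph_inj sg); rewrite sgc.
Qed.

(** Both [z] in [k(w)] and [w] in [k(z)] are known, so [homogenize_degree] applies. *)
Lemma automorphism_moebius : exists A B : {poly k},
  [/\ coprimep A B, B != 0, (size A <= 2)%N, (size B <= 2)%N & z = ev w A / ev w B].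
Proof.
have [A [B [cAB nzB zE]]] := rational_coprime tw z_rational.
have [C [E [cCE nzE wE]]] := rational_coprime tw (automorphism_rational sgVc sgVK).
have {}wE : w * ev z E = ev z C.
  have := congr1 sg wE; rewrite sgK fmorph_div /= !rmorph_ev // -/z => ->.
  by rewrite divfK // ev_eq0.
have nzeB : ev w B != 0 by rewrite ev_eq0.
pose e := (maxn (size C) (size E)).-1.
have maxE : maxn (size C) (size E) = e.+1.
  by rewrite prednK // leq_max !size_poly_gt0 nzE orbT.
have szC : (size C <= e.+1)%N by rewrite -maxE leq_maxl.
have szE : (size E <= e.+1)%N by rewrite -maxE leq_maxr.
have nze : (C`_e != 0) || (E`_e != 0).
  have [leCE|ltEC] := leqP (size C) (size E).
    have eE : e = (size E).-1 by rewrite /e (maxn_idPr leCE).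
    by rewrite eE -lead_coefE lead_coef_eq0 nzE orbT.
  have eC : e = (size C).-1 by rewrite /e (maxn_idPl (ltnW ltEC)).
  by rewrite eC -lead_coefE lead_coef_eq0 -size_poly_gt0 (leq_ltn_trans _ ltEC).
have [|szA szB] := homogenize_degree cAB cCE nze; last by exists A, B.
apply: (ev_inj tw); rewrite rmorphM /= evX.
by rewrite !ev_homogenize // -zE mulrA wE.
Qed.

Let n_ge3 : (3 <= n)%N. Proof. by rewrite nE (leq_trans nu_ge3) // -addnn leq_addr. Qed.

Let size_twisted d : (size ('X^(n.+1) + d *: 'X : {poly k})%R <= n.+2)%N.
Proof.
rewrite (leq_trans (size_polyD _ _)) // geq_max size_polyXn leqnn /=.
by rewrite (leq_trans (size_scale_leq _ _)) // size_polyX.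
Qed.

(* [u] is the image of [s] or [t]. By [square_class], [u ^ 2] is a square times one
   of three polynomials in [w]; clearing denominators, [A B (A ^ n + d B ^ n)] is
   [W ^ 2 P]. Its degree is at most [n + 2] and that of [P] is at least [n + 1], so
   [W] is constant, and [P] is not the polynomial of degree [2 n]. *)
Let branch_polynomial A B (d : k) u : coprimep A B -> B != 0 ->
  (size A <= 2)%N -> (size B <= 2)%N -> z = ev w A / ev w B -> u != 0 -> ~ ratw u ->
  u ^+ 2 = z ^+ n.+1 + kappa d * z ->
  exists c P, [/\ c != 0, P = ps \/ P = pt & A * B * (A ^+ n + d *: B ^+ n) = c *: P].
Proof.
move=> cAB nzB szA szB zE nzu nru u2.
have nzeB : ev w B != 0 by rewrite ev_eq0.
have EF := EF0.
have ru2 : ratw (u ^+ 2).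
  by rewrite u2; have rc := rational_const kappa w d; have rz := z_rational; insub EF.
have [P [b [PP rb u2E]]] := square_class ru2 nzu nru.
pose F := A * B * (A ^+ n + d *: B ^+ n).
have FE : ev w F = (b * ev w B ^+ nu.+1) ^+ 2 * ev w P.
  have -> : ev w F = u ^+ 2 * ev w B ^+ (nu.+1).*2.
    rewrite u2 zE doubleS -nE rmorphM rmorphM rmorphD /= evZ !rmorphXn /= !exprS expr_div_n.
    by field; rewrite nzeB expf_neq0.
  by rewrite u2E -muln2 exprM exprMn; ring.
have nzF : F != 0.
  rewrite -(ev_eq0 _ tw) FE mulf_neq0 //.
    rewrite expf_neq0 // mulf_neq0 ?expf_neq0 //.
    by apply: contraTneq (expf_neq0 2 nzu) => b0; rewrite u2E b0 expr0n mul0r negbK.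
  by apply: contraTneq (expf_neq0 2 nzu) => P0; rewrite u2E P0 mulr0 negbK.
have sepP : separable_poly P by case: PP => ->.
have [W WE] : exists W, b * ev w B ^+ nu.+1 = ev w W.
  apply: (square_free_denominator tw sepP); last by rewrite -FE; apply: integral_id.
  by apply: (subM EF) => //; apply: (subX _ EF); apply: rational_ev.
have {}FE : F = W ^+ 2 * P by apply: (ev_inj tw); rewrite FE WE rmorphM rmorphXn.
have [nzW nzP] : W != 0 /\ P != 0.
  by move: nzF; rewrite FE mulf_eq0 expf_eq0 negb_or /= => /andP.
have szF : (size F <= n.+3)%N.
  exact: size_binary_form.
have sz0 (Q : {poly k}) j : Q`_j != 0 -> (j < size Q)%N.
  by rewrite ltnNge; apply: contraNN => /(nth_default 0) ->.
have szpv : (n.*2 < size pv)%N.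
  by apply: sz0; rewrite coefD coefZ coefXn coefC eqxx gtn_eqF ?double_gt0 // addr0 mulr1 oner_neq0.
have szP : (n.+2 <= size P)%N.
  case: PP => ->.
  - by apply: sz0; rewrite coefD !coefZ coefXn coefX ngt1 eqxx mulr1 mulr0 addr0 oner_neq0.
  - by apply: sz0; rewrite coefD !coefZ coefXn coefX ngt1 eqxx mulr1 mulr0 addr0 oner_neq0.
  - by apply: leq_trans szpv; rewrite -addnn ltnS -[n.+1]/(1 + n)%N leq_add2r.
have szW : size W = 1%N.
  have : (size (W ^+ 2 * P)%R <= n.+3)%N by rewrite -FE.
  have szW0 : (0 < size W)%N by rewrite size_poly_gt0.
  have szW2 : (size (W ^+ 2)%R).-1 = ((size W).-1 * 2)%N by rewrite size_exp.
  have szW20 : (0 < size (W ^+ 2)%R)%N by rewrite size_poly_gt0 expf_neq0.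
  rewrite size_mul ?expf_neq0 //; exact: size_parity szW0 szW20 szW2 szP.
have [c nzc WC] : exists2 c, c != 0 & W = c%:P by apply/size_poly1P/eqP.
exists (c ^+ 2), P; split; first exact: expf_neq0.
  case: PP => PE; [by left | by right | exfalso].
  move: szF; rewrite FE WC -rmorphXn mul_polyC size_scale ?expf_neq0 // PE.
  apply/negP; rewrite -ltnNge (leq_trans _ szpv) // -addnn ltnS.
  by rewrite -[n.+3]/(3 + n)%N leq_add2r n_ge3.
by rewrite -/F FE WC -rmorphXn mul_polyC.
Qed.

(** The Moebius map permutes the branch points [0], [oo] and the [2 n]-th roots of
    [4]; comparing coefficients, it preserves or exchanges [0] and [oo]. *)
Lemma automorphism_w :
  (exists2 c, c ^+ n.*2 = 1 & z = kappa c * w) \/ (exists2 c, c != 0 & z = kappa c / w).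
Proof.
have [A [B [cAB nzB szA szB zE]]] := automorphism_moebius.
have nrat u : ~ ratw u -> ~ ratw (sg u) by move=> nru /rational_pull.
have nrt : ~ ratw t by move=> rt; apply: t_irr; apply: adjoin_sub => //; apply: EF0.
have [|||c1 [P1 [nzc1 PP1 E1]]] := branch_polynomial (d := 2) (u := sg s) cAB nzB szA szB zE.
- by rewrite fmorph_eq0.
- exact: nrat.
- by rewrite -rmorphXn s2 rmorphD rmorphM rmorphXn !rmorph_nat.
have [|||c2 [P2 [nzc2 PP2 E2]]] := branch_polynomial (d := - 2) (u := sg t) cAB nzB szA szB zE.
- by rewrite fmorph_eq0.
- exact: nrat.
- by rewrite -rmorphXn t2 rmorphB rmorphM rmorphXn rmorphN !rmorph_nat mulNr.
rewrite scaleNr in E2.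
have PE P : P = ps \/ P = pt -> exists2 d : k, d ^+ 2 = 4 & P = 'X^(n.+1) + d *: 'X.
  have sq2 : (2 : k) ^+ 2 = 4 by ring.
  by case=> ->; [exists 2|exists (-2)]; rewrite ?sqrrN // ?/ps ?/pt scale1r.
have [d1 d14 P1E] := PE _ PP1; have [d2 d24 P2E] := PE _ PP2.
have P0 (d : k) : ('X^(n.+1) + d *: 'X : {poly k})`_0 = 0.
  by rewrite coefD coefZ coefX coefXn mulr0 addr0.
have szP (d : k) := size_twisted d.
have [top bot] : A`_1 * B`_1 = 0 /\ A`_0 * B`_0 = 0.
  by apply: (@linear_forms_monomial _ A B n c1 c2 P1 P2) => //; rewrite ?P1E ?P2E.
have linE (F : {poly k}) : (size F <= 2)%N -> F = F`_1 *: 'X + (F`_0)%:P.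
  move=> szF; apply/polyP => -[|[|j]]; rewrite coefD coefZ coefX coefC /=
    ?mulr0 ?mulr1 ?add0r ?addr0 //.
  by rewrite nth_default // (leq_trans szF).
have := linE A szA; have := linE B szB.
move=> BE AE.
have evA : ev w A = kappa A`_1 * w + kappa A`_0.
  by rewrite {1}AE rmorphD /= evZ evX evC.
have evB : ev w B = kappa B`_1 * w + kappa B`_0.
  by rewrite {1}BE rmorphD /= evZ evX evC.
move/eqP: top; rewrite mulf_eq0 => /orP[] /eqP top;
  move/eqP: bot; rewrite mulf_eq0 => /orP[] /eqP bot.
- have := transcendental_neq0 transc_z.
  by rewrite zE evA top bot !rmorph0 mul0r add0r mul0r eqxx.
- have z_eq : z = kappa (A`_0 / B`_1) / w.
    by rewrite zE evA evB top bot rmorph0 mul0r add0r addr0 fmorph_div invfM mulrA.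
  right; exists (A`_0 / B`_1) => //; apply: contraTneq (transcendental_neq0 transc_z) => c0.
  by rewrite z_eq c0 rmorph0 mul0r eqxx.
- set a := A`_1 in AE; set b := B`_0 in BE.
  rewrite top scale0r add0r in BE; rewrite bot addr0 in AE.
  have nzb : b != 0 by move: nzB; rewrite BE polyC_eq0.
  have z_eq : z = kappa (a / b) * w by rewrite zE AE BE evC evZ evX fmorph_div mulrAC.
  have nza : a != 0.
    apply: contraTneq (transcendental_neq0 transc_z) => a0.
    by rewrite z_eq a0 mul0r rmorph0 mul0r eqxx.
  left; exists (a / b) => //.
  have {}E1 : (a * b * a ^+ n) *: 'X^(n.+1) + (a * b * (2 * b ^+ n)) *: 'X =
      c1 *: ('X^(n.+1) + d1 *: 'X) :> {poly k}.
    rewrite -P1E -E1 AE BE exprZn -rmorphXn -!mul_polyC !rmorphM exprS /=; ring.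
  have top1 : a * b * a ^+ n = c1.
    have := congr1 (fun p : {poly k} => p`_(n.+1)) E1.
    by rewrite !coefZ !coefD !coefZ !coefXn !coefX eqxx ngt1 !mulr0 !addr0 !mulr1.
  have low1 : a * b * (2 * b ^+ n) = c1 * d1.
    have := congr1 (fun p : {poly k} => p`_1) E1.
    by rewrite !coefZ !coefD !coefZ !coefXn !coefX eq_sym ngt1 !mulr0 !add0r !mulr1.
  have low2 : 2 * b ^+ n = a ^+ n * d1.
    by apply: (mulfI (mulf_neq0 nza nzb)); rewrite low1 -top1 mulrA.
  have := congr1 (fun u => u ^+ 2) low2; rewrite !exprMn d14 -!exprM muln2 => eq2.
  have ab : b ^+ n.*2 = a ^+ n.*2.
    apply: (mulfI nz4); rewrite [RHS]mulrC -eq2; congr (_ * _).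
    by ring.
  by rewrite exprVn ab divff // expf_neq0.
- by move: nzB; rewrite BE top bot scale0r add0r eqxx.
Qed.

End Moebius.
End Curve.

(** * The plane model *)

Lemma odd_square_half j : odd j -> (j * j = (j.-1)./2 * (j.+1).*2 + 1)%N.
Proof.
move=> oj; have -> : j = (j./2).*2.+1 by rewrite -[LHS]odd_double_half oj.
rewrite /= doubleK; move: j./2 => r; lia.
Qed.

(** Here [m = 2 (i + 1)], and [w = y ^ 2 / x], [s = y + y / x], [t = y - y / x] turn the
    plane model into the biquadratic one with [n = i + 1]. *)
Section PlaneModel.
Variables (k : closedFieldType) (K : fieldType) (kappa : {rmorphism k -> K}).
Variables (i : nat) (x y : K).
Hypotheses (odd_i : odd i) (i_ge5 : (4 < i)%N).
Hypotheses (nz2 : 2 != 0 :> k) (nzn : i.+1%:R != 0 :> k).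
Notation m := (i.+1).*2.
Hypothesis K_def : is_function_field kappa m i x y.

Let nz2K : 2 != 0 :> K. Proof. by rewrite -(rmorph_nat kappa) fmorph_eq0. Qed.

Let tx : transcendental kappa x.
Proof.
have [x_tr _ _] := K_def; move=> P Px; apply/eqP; apply: contra_notT x_tr => nzP.
by exists P => //; apply/rootP.
Qed.

Let nzx : x != 0. Proof. exact: transcendental_neq0 tx. Qed.

Lemma quadratic_neq0 (z : K) c d : transcendental kappa z ->
  z ^+ 2 + kappa c * z + kappa d != 0.
Proof.
move=> tz; have -> : z ^+ 2 + kappa c * z + kappa d = ev kappa z ('X^2 + c *: 'X + d%:P).
  by rewrite !rmorphD /= evXn evZ evX evC.
rewrite ev_eq0 // -size_poly_eq0 -addrA size_polyDl size_polyXn //.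
rewrite (leq_ltn_trans (size_polyD _ _)) // ltnS geq_max.
rewrite (leq_trans (size_scale_leq _ _)) ?size_polyX //.
by rewrite (leq_trans (size_polyC_leq1 _)).
Qed.

(** The change of model is done for an arbitrary point [(X, Y)] of the curve: it
    serves for [(x, y)] and for its images under endomorphisms. *)
Section Point.
Variables X Y : K.
Hypotheses (tX : transcendental kappa X) (XY : Y ^+ m = X ^+ i * (X ^+ 2 + 1)).
Let nzX : X != 0. Proof. exact: transcendental_neq0 tX. Qed.
Let W := Y ^+ 2 / X.

Lemma point_w : W ^+ i.+1 = X + X^-1.
Proof.
rewrite /W expr_div_n -exprM mul2n XY [X ^+ i.+1]exprS; field.
by rewrite nzX expf_neq0.
Qed.

Lemma point_s : (Y + Y / X) ^+ 2 = W ^+ i.+2 + 2 * W.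
Proof. by rewrite [W ^+ i.+2]exprSr point_w /W; field. Qed.

Lemma point_t : (Y - Y / X) ^+ 2 = W ^+ i.+2 - 2 * W.
Proof. by rewrite [W ^+ i.+2]exprSr point_w /W; field. Qed.

Lemma point_transcendental : transcendental kappa W.
Proof.
apply: transcendental_closed => c Wc.
have := quadratic_neq0 (- c ^+ i.+1) 1 tX; rewrite rmorphN rmorphXn rmorph1 /= -Wc point_w.
by rewrite (_ : _ + _ + _ = 0) ?eqxx //; field.
Qed.

Lemma point_y_neq0 : Y != 0.
Proof.
have : Y ^+ m != 0.
  rewrite XY mulf_neq0 ?expf_neq0 //.
  by have := quadratic_neq0 0 1 tX; rewrite rmorph0 mul0r addr0 rmorph1.
by apply: contraNneq => ->; rewrite expr0n.
Qed.
End Point.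

Let xy : y ^+ m = x ^+ i * (x ^+ 2 + 1). Proof. by have [] := K_def. Qed.
Let w := y ^+ 2 / x.
Let s := y + y / x.
Let t := y - y / x.
Let tw : transcendental kappa w. Proof. exact: point_transcendental tx xy. Qed.
Let nzy : y != 0. Proof. exact: point_y_neq0 tx xy. Qed.

Lemma function_field_gen (E : K -> Prop) : is_subfield E ->
  (forall c, E (kappa c)) -> E x -> E y -> forall z, E z.
Proof.
move=> EF Ec Ex Ey z; have [_ _ gen] := K_def.
have [P [Q [_ ->]]] := gen z.
have Eev (R : {poly {poly k}}) : E (map_poly (map_poly kappa) R).[x, y].
  elim/poly_ind: R => [|R c IH]; first by rewrite rmorph0 !horner0; apply: (sub0 EF).
  rewrite rmorphD rmorphM /= map_polyX map_polyC /= !hornerE.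
  apply: (subD EF); first by apply: (subM EF).
  by rewrite -evE; apply: subfield_ev.
by apply: (subM EF) => //; apply: (subV EF).
Qed.

Let stE : s - t = 2 * (y / x). Proof. by rewrite /s /t; ring. Qed.
Let yE : y = (s + t) / 2. Proof. by rewrite /s /t; field; rewrite ?nz2K ?nzx. Qed.
Let xE : x = (s + t) / (s - t).
Proof. by rewrite stE /s /t; field; rewrite nz2K nzy nzx. Qed.

Lemma function_field_biquadratic z : adjoin (adjoin (rational_in kappa w) s) t z.
Proof.
have EF0 := rational_subfield kappa w; have rw : rational_in kappa w w by apply: rational_gen.
have r2 c : rational_in kappa w (kappa c) by apply: rational_const.
have rw1 : rational_in kappa w (w ^+ i.+2) by apply: (subX _ EF0).
have r2' : rational_in kappa w 2 by rewrite -(rmorph_nat kappa).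
have EF1 : is_subfield (adjoin (rational_in kappa w) s).
  apply: adjoin_sqrt_subfield => //; rewrite (point_s tx xy) -/w.
  by insub EF0.
have EF : is_subfield (adjoin (adjoin (rational_in kappa w) s) t).
  apply: adjoin_sqrt_subfield => //; rewrite (point_t tx xy) -/w.
  by apply: adjoin_sub => //; insub EF0.
have up u : rational_in kappa w u -> adjoin (adjoin (rational_in kappa w) s) t u.
  by move=> ru; do 2!apply: adjoin_sub => //.
have Es : adjoin (adjoin (rational_in kappa w) s) t s.
  by apply: adjoin_sub => //; apply: adjoin_gen.
have Et : adjoin (adjoin (rational_in kappa w) s) t t by apply: adjoin_gen.
apply: function_field_gen => //.
- by move=> c; apply: up.
- by rewrite xE; insub EF.
- by have E2 := up _ r2'; rewrite yE; insub EF.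
Qed.

(** The curve determines the function field: points of the curve with
    transcendental [X] are the images of [(x, y)] under endomorphisms. *)
Lemma function_field_hom X Y : transcendental kappa X ->
  Y ^+ m = X ^+ i * (X ^+ 2 + 1) ->
  exists f : {rmorphism K -> K}, [/\ forall c, f (kappa c) = kappa c, f x = X & f y = Y].
Proof.
move=> tX XY; have nzX := transcendental_neq0 tX; have nzY := point_y_neq0 tX XY.
have nE : i.+1 = (i.+1)./2.*2 by rewrite -[LHS]odd_double_half /= odd_i.
have nu_ge3 : (2 < (i.+1)./2)%N by rewrite -ltn_double -nE /=; move: i_ge5 odd_i; lia.
have [f [fc fw fs ft]] := curve_hom nE nu_ge3 nz2 nzn tw (point_s tx xy) (point_t tx xy)
   function_field_biquadratic (point_transcendental tX XY) (point_s tX XY) (point_t tX XY).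
exists f; split=> //.
  rewrite xE fmorph_div rmorphB rmorphD /= fs ft.
  have -> : Y + Y / X - (Y - Y / X) = 2 * (Y / X) by ring.
  by field; rewrite nz2K nzX nzY.
by rewrite yE fmorph_div rmorphD rmorph_nat /= fs ft; field; rewrite ?nz2K ?nzX.
Qed.

Lemma function_field_hom_eq (f g : {rmorphism K -> K}) :
  (forall c, f (kappa c) = g (kappa c)) -> f x = g x -> f y = g y -> f =1 g.
Proof.
move=> fc fx fy; apply: function_field_gen => //; split; first by rewrite !rmorph1.
- by move=> a b; rewrite !rmorphB => -> ->.
- by move=> a b; rewrite !rmorphM => -> ->.
- by move=> a; rewrite !fmorphV => ->.
Qed.

(** The image of an endomorphism is a subfield, so surjectivity is a matter of
    hitting the two generators. *)
Lemma function_field_hom_surj (f : {rmorphism K -> K}) (E := fun u => exists v, f v = u) :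
  (forall c, f (kappa c) = kappa c) -> E x -> E y -> bijective f.
Proof.
move=> fc Ex Ey; have /choice[g fK] : forall z, E z.
  apply: function_field_gen => //; last by move=> c; exists (kappa c).
  split; first by exists 1; rewrite rmorph1.
  - by move=> _ _ [a <-] [b <-]; exists (a - b); rewrite rmorphB.
  - by move=> _ _ [a <-] [b <-]; exists (a * b); rewrite rmorphM.
  - by move=> _ [a <-]; exists a^-1; rewrite fmorphV.
by exists g => // z; apply: (fmorph_inj f); rewrite fK.
Qed.

Notation aut := (fieldAut kappa).

Lemma fieldAut_rmorphism f : aut f -> exists F G : {rmorphism K -> K},
  [/\ f = F, cancel F G, cancel G F, forall c, F (kappa c) = kappa c
    & forall c, G (kappa c) = kappa c].
Proof.
move=> [fa fm [g fg gf] fc].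
have ga : zmod_morphism g.
  by move=> a b; rewrite -{1}(gf a) -{1}(gf b) -fa fg.
have gm : monoid_morphism g.
  split; first by rewrite -{1}fm.1 fg.
  by move=> a b; rewrite -{1}(gf a) -{1}(gf b) -fm.2 fg.
pose Fa := GRing.isZmodMorphism.Build K K f fa.
pose Fm := GRing.isMonoidMorphism.Build K K f fm.
pose Ga := GRing.isZmodMorphism.Build K K g ga.
pose Gm := GRing.isMonoidMorphism.Build K K g gm.
pose F : {rmorphism K -> K} := HB.pack f Fa Fm.
pose G : {rmorphism K -> K} := HB.pack g Ga Gm.
by exists F, G; split=> // c; rewrite /= -{1}(fc c) fg.
Qed.

Lemma rmorphism_fieldAut (F : {rmorphism K -> K}) : bijective F ->
  (forall c, F (kappa c) = kappa c) -> aut F.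
Proof.
move=> Fb Fc; split=> //; first exact: rmorphB.
by split; [exact: rmorph1 | exact: rmorphM].
Qed.

Lemma fieldAut_subgroup : comp_subgroup aut.
Proof.
split.
- by split=> //; exists id.
- move=> f g /fieldAut_rmorphism[F [F' [-> FK F'K Fc _]]].
  move=> /fieldAut_rmorphism[G [G' [-> GK G'K Gc _]]].
  apply: (@rmorphism_fieldAut (F \o G : {rmorphism K -> K})).
    by exists (G' \o F'); apply: can_comp.
  by move=> c /=; rewrite Gc.
- move=> f g /fieldAut_rmorphism[F [F' [-> FK F'K _ F'c]]] Fg gF.
  have -> : g = F' by apply: funext => u; rewrite -{1}(F'K u) Fg.
  by apply: rmorphism_fieldAut => //; exists F.
Qed.

Let sign_odd_exp (e : k) : e ^+ 2 = 1 -> e ^+ i = e.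
Proof.
by move=> e2; rewrite -(odd_double_half i) odd_i exprS -mul2n exprM e2 expr1n mulr1.
Qed.

Let unity_neq0 (a : k) : a ^+ (2 * m) = 1 -> a != 0.
Proof. by move=> am; apply: contra_eqN am => /eqP->; rewrite expr0n eq_sym oner_neq0. Qed.

Lemma scale_exists a : a ^+ (2 * m) = 1 ->
  exists f, [/\ aut f, f x = kappa (a ^+ m) * x & f y = kappa a * y].
Proof.
move=> a2m; have am2 : (a ^+ m) ^+ 2 = 1 by rewrite -exprM mulnC.
have nza := unity_neq0 a2m.
have nzam : a ^+ m != 0 by rewrite expf_neq0.
have ami : (a ^+ m) ^+ i = a ^+ m by apply: sign_odd_exp.
have tX : transcendental kappa (kappa (a ^+ m) * x).
  apply: transcendental_closed => c xc; apply: (transcendental_neq (c := c / a ^+ m) tx).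
  by rewrite fmorph_div -xc mulrC mulKf // fmorph_eq0.
have [|f [fc fx fy]] := function_field_hom (Y := kappa a * y) tX.
  rewrite [LHS]exprMn xy !exprMn -!rmorphXn ami am2 rmorph1 mul1r; ring.
exists f; split=> //; apply: rmorphism_fieldAut => //.
apply: function_field_hom_surj => //.
- exists (kappa (a ^+ m)^-1 * x); rewrite rmorphM /= fx fc mulrA -rmorphM mulVf //.
  by rewrite rmorph1 mul1r.
- exists (kappa a^-1 * y); rewrite rmorphM /= fy fc mulrA -rmorphM mulVf //.
  by rewrite rmorph1 mul1r.
Qed.

Lemma inversion_exists : exists f, [/\ aut f, f x = x^-1 & f y = y / x].
Proof.
have tX : transcendental kappa x^-1.
  apply: transcendental_closed => c xc; apply: (transcendental_neq (c := c^-1) tx).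
  by rewrite fmorphV -xc invrK.
have [|f [fc fx fy]] := function_field_hom (Y := y / x) tX.
  rewrite expr_div_n xy -addnn exprD [x ^+ i.+1]exprS exprVn; field.
  by rewrite nzx expf_neq0.
exists f; split=> //; apply: rmorphism_fieldAut => //.
apply: function_field_hom_surj => //.
- by exists x^-1; rewrite fmorphV fx invrK.
- by exists (y / x); rewrite fmorph_div fx fy invrK divfK.
Qed.

Let exp_half := odd_square_half odd_i.

(** With [J ^ 2 = -1] and [X = (x + J) / (J x + 1)], one has
    [X ^ 2 + 1 = 4 x / (J (x - J) ^ 2)]; the exponents match because
    [i ^ 2 = m (i - 1) / 2 + 1], and the same relation recovers [y] from [y ^ i]
    and [y ^ m] in the image. *)
Lemma rotation_exists : exists f, aut f /\ gen_rot kappa m i x y f.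
Proof.
have root_ex (c : k) d : (0 < d)%N -> exists b, b ^+ d = c.
  move=> d0; have [b] := solve_monicpoly (fun j => if j == 0%N then c else 0) d0.
  case: d d0 => // d _; rewrite big_ord_recl /= mulr1 big1 ?addr0 => [<-|j _]; first by exists b.
  by rewrite mul0r.
have [I I2] := root_ex (- 1) 2 isT.
have nzI : I != 0 by apply: contra_eqN I2 => /eqP->; rewrite expr0n eq_sym oppr_eq0 oner_neq0.
have [c cm] := root_ex (4 / I ^+ i.+1) m isT.
have {}cm : c ^+ m * I ^+ i.+1 = 4 by rewrite cm divfK // expf_neq0.
have nzc : c != 0.
  apply: contra_eqN cm => /eqP->; rewrite expr0n mul0r eq_sym.
  by rewrite (_ : 4 = 2 * 2) ?mulf_neq0 // -natrM.
pose J := kappa I; have J2 : J ^+ 2 = -1 by rewrite -rmorphXn I2 rmorphN rmorph1.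
have nzJ : J != 0 by rewrite fmorph_eq0.
have nz1 : x - J != 0 by rewrite subr_eq0; apply/eqP; apply: transcendental_neq.
have nz1' : x + J != 0.
  by rewrite -[J]opprK -rmorphN subr_eq0; apply/eqP; apply: transcendental_neq.
have den : J * x + 1 = J * (x - J) by rewrite mulrBr -expr2 J2 opprK.
have nzd : J * x + 1 != 0 by rewrite den mulf_neq0.
pose X := (x + J) / (J * x + 1).
have XJ1 : (1 - J * X) * (J * x + 1) = 2.
  rewrite mulrBl mul1r -mulrA divfK //.
  transitivity (1 - J ^+ 2); first by ring.
  by rewrite J2 opprK.
have XJ2 : (X - J) * (J * x + 1) = 2 * x.
  rewrite mulrBl divfK //.
  transitivity (x - J ^+ 2 * x); first by ring.
  by rewrite J2; ring.
have nz1X : 1 - J * X != 0.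
  by apply: contra_eqN XJ1 => /eqP->; rewrite mul0r eq_sym.
have xX : x = (X - J) / (1 - J * X).
  apply: (mulIf nz1X); rewrite divfK //; apply: (mulIf nzd).
  by rewrite XJ2 -mulrA XJ1 mulrC.
have tX : transcendental kappa X.
  apply: transcendental_closed => d Xd.
  apply: (transcendental_neq (c := (d - I) / (1 - I * d)) tx).
  by rewrite fmorph_div !rmorphB rmorphM rmorph1 /= -/J -Xd.
pose Y := kappa c * y ^+ i / (x ^+ (i.-1)./2 * (x - J)).
have XY : Y ^+ m = X ^+ i * (X ^+ 2 + 1).
  have X21 : X ^+ 2 + 1 = 4 * x / (J * (x - J) ^+ 2).
    have -> : X ^+ 2 + 1 = ((x + J) ^+ 2 + J ^+ 2 * (x - J) ^+ 2) / (J ^+ 2 * (x - J) ^+ 2).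
      by rewrite /X den; field; rewrite nzJ nz1.
    have -> : (x + J) ^+ 2 + J ^+ 2 * (x - J) ^+ 2 = 4 * J * x by rewrite J2; ring.
    by field; rewrite nzJ nz1.
  have yi : (y ^+ i) ^+ m = (x ^+ (i.-1)./2) ^+ m * x * (x ^+ 2 + 1) ^+ i.
    rewrite -exprM mulnC exprM xy exprMn -!exprM exp_half exprD expr1.
    by [].
  have x21 : x ^+ 2 + 1 = (x - J) * (x + J) by rewrite -subr_sqr J2 opprK.
  rewrite X21 /X /Y den !(exprMn, exprVn, expr_div_n) yi x21 !exprMn.
  have -> : (x - J) ^+ m = (x - J) ^+ i * (x - J) ^+ 2 * (x - J) ^+ i.
    by rewrite -!exprD -addnn addSnnS addn2 addnC.
  have cmK : 4 = kappa c ^+ m * (J ^+ i * J) by rewrite -exprSr -!rmorphXn -rmorphM cm rmorph_nat.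
  rewrite cmK; field.
  by rewrite ?nzJ ?nz1 ?expf_neq0.
have [f [fc fx fy]] := function_field_hom tX XY.
exists f; split; last by exists I, c; split.
apply: rmorphism_fieldAut => //.
have Ex : exists u, f u = x.
  exists ((x - J) / (1 - J * x)).
  by rewrite fmorph_div !rmorphB rmorphM rmorph1 /= !fc fx -xX.
apply: function_field_hom_surj => //.
have [u ux] := Ex; pose v := y * u ^+ (i.-1)./2 * (u - J) / kappa c.
have fv : f v = y ^+ i.
  rewrite /v fmorph_div !rmorphM rmorphB rmorphXn /= fy !fc ux /Y; field.
  by rewrite fmorph_eq0 nzc nz1 expf_neq0.
exists (v ^+ i / (u ^+ i * (u ^+ 2 + 1)) ^+ (i.-1)./2).
rewrite fmorph_div !rmorphXn rmorphM rmorphD !rmorphXn rmorph1 /= fv ux -xy.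
have -> : y ^+ i ^+ i = (y ^+ m) ^+ (i.-1)./2 * y.
  by rewrite -!exprM exp_half exprD expr1 mulnC.
by rewrite mulrAC divff ?mul1r // !expf_neq0.
Qed.

Let nE : i.+1 = (i.+1)./2.*2.
Proof. by rewrite -[LHS]odd_double_half /= odd_i. Qed.
Let nu_ge3 : (2 < (i.+1)./2)%N.
Proof. by rewrite -ltn_double -nE /=; move: i_ge5 odd_i; lia. Qed.

Lemma automorphism_cases f : aut f ->
  (exists2 c, c ^+ m = 1 & f w = kappa c * w) \/ (exists2 c, c != 0 & f w = kappa c / w).
Proof.
move=> /fieldAut_rmorphism[F [G [-> FK GK Fc Gc]]].
exact: (automorphism_w nE nu_ge3 nz2 nzn tw (point_s tx xy) (point_t tx xy)
  function_field_biquadratic Fc Gc GK FK).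
Qed.

Lemma automorphism_eq f g : aut f -> aut g -> f x = g x -> f y = g y -> f = g.
Proof.
move=> /fieldAut_rmorphism[F [_ [-> _ _ Fc _]]] /fieldAut_rmorphism[G [_ [-> _ _ Gc _]]].
move=> fx fy; apply/funext/function_field_hom_eq => // c.
by rewrite Fc Gc.
Qed.

(** An automorphism that multiplies [w] by a constant permutes the two roots
    [x], [1 / x] of [X + 1 / X = w ^ (i + 1)] up to sign. *)
Lemma automorphism_fixing_w f c : aut f -> c ^+ m = 1 -> f w = kappa c * w ->
  exists a, a ^+ (2 * m) = 1 /\
    ((f x = kappa (a ^+ m) * x /\ f y = kappa a * y) \/
     (f x = (kappa (a ^+ m) * x)^-1 /\ f y = kappa a * y / (kappa (a ^+ m) * x))).
Proof.
move=> autf cm fw; have [F [G [fE FK GK Fc Gc]]] := fieldAut_rmorphism autf.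
rewrite fE in fw *.
pose e := c ^+ i.+1.
have e2 : e ^+ 2 = 1 by rewrite -exprM muln2.
have nze : e != 0 by apply: contra_eqN e2 => /eqP->; rewrite expr0n eq_sym oner_neq0.
have eV : e^-1 = e by apply: (mulfI nze); rewrite divff // -expr2.
have nzX : F x != 0 by rewrite fmorph_eq0.
have nzeK : kappa e != 0 by rewrite fmorph_eq0.
have eqx : F x + (F x)^-1 = kappa e * (x + x^-1).
  rewrite -fmorphV -rmorphD -(point_w tx xy) -/w rmorphXn /= fw exprMn -rmorphXn.
  by rewrite (point_w tx xy).
have Fy2 : F y ^+ 2 = kappa c * w * F x.
  by rewrite -fw /w fmorph_div rmorphXn /= divfK.
(* Up to sign, [F y] is [b y] or [b y / x], because [(F y) ^ 2 = F w * F x]. *)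
have [b b2] : exists b, b ^+ 2 = c * e.
  have [b] := solve_monicpoly (fun j => if j == 0%N then c * e else 0) (isT : 0 < 2)%N.
  by rewrite !big_ord_recl big_ord0 /= mulr1 mul0r !addr0 => <-; exists b.
have bm (u : k) : u ^+ 2 = c * e -> u ^+ m = e.
  rewrite -mul2n exprM => ->; rewrite exprMn -/e nE -mul2n exprM.
  by rewrite [e ^+ 2]e2 expr1n mulr1.
have bm2 (u : k) : u ^+ m = e -> u ^+ (2 * m) = 1 by rewrite mulnC exprM => ->.
have : (F x - kappa e * x) * (F x - kappa e / x) = 0.
  have e2K : kappa e ^+ 2 = 1 by rewrite -rmorphXn e2 rmorph1.
  transitivity (F x ^+ 2 - (kappa e * (x + x^-1)) * F x + kappa e ^+ 2).
    by field.
  by rewrite -eqx e2K; field.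
move/eqP; rewrite mulf_eq0 !subr_eq0 => /orP[]/eqP Fx.
- have : F y ^+ 2 = (kappa b * y) ^+ 2.
    by rewrite Fy2 Fx exprMn -rmorphXn b2 rmorphM /w; field.
  move/eqP; rewrite eqf_sqr => /orP[]/eqP Fy.
    by exists b; split; [exact/bm2/bm | left; rewrite (bm b b2)].
  exists (- b); rewrite rmorphN mulNr (bm (- b)) ?sqrrN //; split; last by left.
  by apply/bm2/bm; rewrite sqrrN.
- have key u : u ^+ 2 = c * e -> F y = kappa u * y / x -> exists a, a ^+ (2 * m) = 1 /\
    ((F x = kappa (a ^+ m) * x /\ F y = kappa a * y) \/
     (F x = (kappa (a ^+ m) * x)^-1 /\ F y = kappa a * y / (kappa (a ^+ m) * x))).
    move=> u2 Fy; have uem : (u * e) ^+ m = e.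
      by apply: bm; rewrite exprMn u2 e2 mulr1.
    exists (u * e); split; first exact: bm2.
    right; rewrite uem Fx Fy invfM -fmorphV eV; split=> //.
    have eeK : kappa e * kappa e = 1 by rewrite -rmorphM -expr2 e2 rmorph1.
    by rewrite rmorphM -[LHS]mulr1 -eeK /=; ring.
  have : F y ^+ 2 = (kappa b * y / x) ^+ 2.
    by rewrite Fy2 Fx expr_div_n exprMn -rmorphXn b2 rmorphM /w; field.
  move/eqP; rewrite eqf_sqr => /orP[]/eqP Fy; first exact: (key b).
  by apply: (key (- b)); rewrite ?sqrrN // rmorphN Fy !mulNr.
Qed.

Lemma square_not_constant z c : transcendental kappa z -> z * z <> kappa c.
Proof.
move=> tz ww; have := quadratic_neq0 0 (- c) tz.
by rewrite rmorph0 mul0r addr0 rmorphN expr2 ww subrr eqxx.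
Qed.

(** From [w ^ (i + 1) = x + 1 / x] one computes [(f w) ^ (i + 1) = 4 / w ^ (i + 1)]; an
    automorphism multiplying [w] by a constant would make [w] algebraic. *)
Lemma rotation_w f : aut f -> gen_rot kappa m i x y f ->
  exists2 c, c != 0 & f w = kappa c / w.
Proof.
move=> autf [I [c [I2 _ fx _]]]; have [[d dm fw]|//] := automorphism_cases autf.
have [F [G [fE FK GK Fc Gc]]] := fieldAut_rmorphism autf; rewrite fE in fx fw.
pose J := kappa I; have J2 : J ^+ 2 = -1 by rewrite -rmorphXn I2 rmorphN rmorph1.
have nzJ : J != 0 by apply: contra_eqN J2 => /eqP->; rewrite expr0n eq_sym oppr_eq0 oner_neq0.
have nz1 : x - J != 0 by rewrite subr_eq0; apply/eqP; apply: transcendental_neq.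
have nz1' : x + J != 0.
  by rewrite -[J]opprK -rmorphN subr_eq0; apply/eqP; apply: transcendental_neq.
have nzX : x ^+ 2 + 1 != 0.
  by have := quadratic_neq0 0 1 tx; rewrite rmorph0 mul0r addr0 rmorph1.
have den : J * x + 1 = J * (x - J) by rewrite mulrBr -expr2 J2 opprK.
have Fw : F w ^+ i.+1 * w ^+ i.+1 = 4.
  rewrite -rmorphXn /= (point_w tx xy) rmorphD fmorphV /= fx -/J den.
  have -> : (x + J) / (J * (x - J)) + ((x + J) / (J * (x - J)))^-1 =
    ((x + J) ^+ 2 + J ^+ 2 * (x - J) ^+ 2) / (J * ((x - J) * (x + J))).
    by field; rewrite nzJ nz1 nz1'.
  have -> : (x + J) ^+ 2 + J ^+ 2 * (x - J) ^+ 2 = 4 * J * x by rewrite J2; ring.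
  have -> : (x - J) * (x + J) = x ^+ 2 + 1 by rewrite -subr_sqr J2 opprK.
  by field; rewrite nzJ nzx nzX.
have dw : kappa (d ^+ i.+1) * w ^+ m = 4.
  by rewrite -Fw fw [(_ * w) ^+ _]exprMn rmorphXn -addnn exprD mulrA.
have nzd : d ^+ i.+1 != 0.
  by rewrite expf_neq0 //; apply: contra_eqN dm => /eqP->; rewrite expr0n eq_sym oner_neq0.
have := tw (P := 'X^m - (4 / d ^+ i.+1)%:P).
rewrite rmorphB /= evXn evC fmorph_div rmorph_nat -dw mulrC mulrA mulVf ?fmorph_eq0 //.
by rewrite mul1r subrr => /(_ erefl) /eqP; rewrite (negPf (monic_neq0 (monicXnsubC _ _))).
Qed.

(** Every automorphism is a normal form [word e a d]: at most one rotation, one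
    scaling, at most one inversion. *)
Section Word.
Variables (rot inv : K -> K) (sc : k -> K -> K).
Hypotheses (rot_aut : aut rot) (rotP : gen_rot kappa m i x y rot)
  (inv_aut : aut inv) (inv_x : inv x = x^-1) (inv_y : inv y = y / x)
  (sc_aut : forall a, a ^+ (2 * m) = 1 -> aut (sc a))
  (sc_x : forall a, a ^+ (2 * m) = 1 -> sc a x = kappa (a ^+ m) * x)
  (sc_y : forall a, a ^+ (2 * m) = 1 -> sc a y = kappa a * y).

Definition word (e : bool) (a : k) (d : bool) : K -> K :=
  (if e then rot else idfun) \o (sc a \o (if d then inv else idfun)).

Lemma word_mem G : comp_subgroup G ->
  ([set f | aut f /\ [\/ gen_scale kappa m x y f, gen_inv x y f | gen_rot kappa m i x y f]]
     `<=` G)%classic ->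
  forall e a d, a ^+ (2 * m) = 1 -> G (word e a d).
Proof.
move=> [G1 GM _] gG e a d am; have Grot : G rot by apply: gG; split=> //; constructor 3.
have Ginv : G inv by apply: gG; split=> //; constructor 2.
have Gsc : G (sc a).
  by apply: gG; split; [exact: sc_aut | constructor 1; exists a; rewrite sc_x ?sc_y].
by apply: (GM); [case: e | apply: (GM) => //; case: d].
Qed.

Lemma word_aut e a d : a ^+ (2 * m) = 1 -> aut (word e a d).
Proof.
by apply: word_mem => [|f []//]; apply: fieldAut_subgroup.
Qed.

Lemma sc_inv_w a d : a ^+ (2 * m) = 1 ->
  word false a d w = kappa (a ^+ 2 / a ^+ m) * w.
Proof.
move=> am; have [I1 [I' [IE _ _ _ _]]] := fieldAut_rmorphism inv_aut.
have [S1 [S' [SE _ _ _ _]]] := fieldAut_rmorphism (sc_aut am).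
have nza : a ^+ m != 0.
  by rewrite expf_neq0 // unity_neq0.
have -> : word false a d w = sc a w.
  rewrite /word /=; case: d => //=; rewrite -[inv w]/(inv (y ^+ 2 / x)).
  move: inv_x inv_y; rewrite IE => ix iy; rewrite fmorph_div rmorphXn /= ix iy.
  congr (sc a _); rewrite /w expr_div_n invrK; field.
  exact: nzx.
have := sc_x am; have := sc_y am; rewrite SE => Sy Sx.
rewrite [kappa (_ / _)]fmorph_div /w [S1 _]fmorph_div rmorphXn /= Sx Sy; rewrite rmorphXn; field.
have ka : kappa a != 0 by rewrite fmorph_eq0; apply: contraNneq nza => ->; rewrite expr0n.
by apply/andP; split; [exact: nzx | exact: expf_neq0].
Qed.

(** An automorphism that inverts [w] up to a constant stops doing so after
    composition with the inverse of the rotation. *)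
Lemma word_complete f : aut f -> exists e a d, a ^+ (2 * m) = 1 /\ f = word e a d.
Proof.
have base g c : aut g -> c ^+ m = 1 -> g w = kappa c * w ->
    exists a d, a ^+ (2 * m) = 1 /\ g = word false a d.
  move=> autg cm gw; have [a [am gxy]] := automorphism_fixing_w autg cm gw.
  have [I1 [_ [IE _ _ _ _]]] := fieldAut_rmorphism inv_aut.
  have [S1 [_ [SE _ _ _ _]]] := fieldAut_rmorphism (sc_aut am).
  case: gxy => -[gx gy].
    exists a, false; split=> //; apply: automorphism_eq => //; first exact: word_aut.
    - by rewrite gx /word /= sc_x.
    - by rewrite gy /word /= sc_y.
  exists a, true; split=> //; apply: automorphism_eq => //; first exact: word_aut.
  - rewrite gx /word /= inv_x -(sc_x am) SE fmorphV; by [].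
  - rewrite gy /word /= inv_y -(sc_x am) -(sc_y am) SE fmorph_div; by [].
move=> autf; have [[c cm fw]|[c nzc fw]] := automorphism_cases autf.
  by have [a [d ad]] := base f c autf cm fw; exists false, a, d.
have [r nzr rw] := rotation_w rot_aut rotP.
have [R [R' [RE RK R'K Rc R'c]]] := fieldAut_rmorphism rot_aut.
have nzw := transcendental_neq0 tw.
have R'w : R' w = kappa r / w.
  have := congr1 R' rw; rewrite RE RK fmorph_div /= R'c => e.
  have nzR'w : R' w != 0 by rewrite fmorph_eq0.
  by apply: (mulfI nzw); rewrite {1}e divfK // [RHS]mulrC divfK.
pose g := R' \o f.
have autR' : aut R' by apply: rmorphism_fieldAut => //; exists R.
have autg : aut g by case: fieldAut_subgroup => _ cM _; apply: cM.
have gw : g w = kappa (c / r) * w.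
  rewrite /g /= fw fmorph_div /= R'c R'w fmorph_div; field.
  by rewrite nzw !fmorph_eq0 nzr.
have fE : f = rot \o g by apply: funext => u; rewrite /g /= RE R'K.
have [[c' cm' gw']|[c' _ gw']] := automorphism_cases autg; last first.
  exfalso; apply: (@square_not_constant w (c' / (c / r)) tw).
  have nzcr : kappa (c / r) != 0 by rewrite fmorph_eq0 mulf_neq0 ?invr_eq0.
  apply: (mulfI nzcr); rewrite mulrA -gw gw' divfK // [kappa (c' / _)]fmorph_div.
  by rewrite mulrC divfK.
have [a [d [am gE]]] := base g c' autg cm' gw'.
exists true, a, d; split=> //; rewrite fE gE; by [].
Qed.

(** The action on [w] determines [e]; then the action on [x] determines [d], and
    that on [y] determines [a]. *)
Lemma word_inj e a d e' a' d' : a ^+ (2 * m) = 1 -> a' ^+ (2 * m) = 1 ->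
  word e a d = word e' a' d' -> [/\ e = e', a = a' & d = d'].
Proof.
move=> am am' eqw.
have [R [R' [RE RK R'K Rc R'c]]] := fieldAut_rmorphism rot_aut.
have [r nzr rw] := rotation_w rot_aut rotP.
have nzw := transcendental_neq0 tw.
have nza b : b ^+ (2 * m) = 1 -> kappa (b ^+ 2 / b ^+ m) != 0.
  move=> /unity_neq0 nzb; rewrite fmorph_eq0; apply: mulf_neq0; first exact: expf_neq0.
  by rewrite invr_eq0 expf_neq0.
have nmix b1 b2 d1 d2 : b1 ^+ (2 * m) = 1 -> b2 ^+ (2 * m) = 1 ->
    word true b1 d1 <> word false b2 d2.
  move=> bm1 bm2 /(congr1 (fun f => f w)); rewrite sc_inv_w //.
  rewrite -[word true b1 d1 w]/(rot (word false b1 d1 w)) sc_inv_w // RE rmorphM /= Rc.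
  rewrite -RE rw => eqc.
  move: (nza _ bm2) eqc; move: (b1 ^+ 2 / _) (b2 ^+ 2 / _) => u1 u2 nzu2 eqc.
  apply: (@square_not_constant w (u1 * r / u2) tw).
  apply: (mulfI nzu2); rewrite mulrA -eqc mulrA divfK //.
  by rewrite fmorph_div rmorphM /= [RHS]mulrC divfK.
have ee : e = e'.
  case: e e' eqw => -[] // eqw; first by case: (nmix _ _ _ _ am am' eqw).
  by case: (nmix _ _ _ _ am' am (esym eqw)).
have {}eqw : word false a d = word false a' d'.
  move: eqw; rewrite -ee; case: (e) => // eqw; apply: funext => u.
  by apply: (fmorph_inj R); have := congr1 (fun f => f u) eqw; rewrite /word /= RE.
have [I [I' [IE IK I'K _ _]]] := fieldAut_rmorphism inv_aut.
have nzam b : b ^+ (2 * m) = 1 -> kappa (b ^+ m) != 0.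
  by move=> /unity_neq0 nzb; rewrite fmorph_eq0 expf_neq0.
have wordx b (bm : b ^+ (2 * m) = 1) :
    word false b true x = (kappa (b ^+ m) * x)^-1 /\ word false b false x = kappa (b ^+ m) * x.
  have [S1 [_ [SE _ _ _ _]]] := fieldAut_rmorphism (sc_aut bm).
  by rewrite /word /= inv_x -(sc_x bm) SE fmorphV.
have nmix' b1 b2 : b1 ^+ (2 * m) = 1 -> b2 ^+ (2 * m) = 1 ->
    word false b1 true <> word false b2 false.
  move=> bm1 bm2 /(congr1 (fun f => f x)); rewrite (wordx _ bm1).1 (wordx _ bm2).2 => eqx.
  apply: (@square_not_constant x (b1 ^+ m * b2 ^+ m)^-1 tx).
  have nz12 : kappa (b1 ^+ m * b2 ^+ m) != 0 by rewrite rmorphM mulf_neq0 ?nzam.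
  apply: (mulfI nz12); rewrite fmorphV divff // rmorphM.
  transitivity (kappa (b1 ^+ m) * x * (kappa (b2 ^+ m) * x)); first by ring.
  by rewrite -eqx divff // mulf_neq0 ?nzam.
have dd : d = d'.
  case: d d' eqw => -[] // eqw; first by case: (nmix' _ _ am am' eqw).
  by case: (nmix' _ _ am' am (esym eqw)).
split=> //; apply: (fmorph_inj kappa); apply: (mulIf nzy).
rewrite -(sc_y am) -(sc_y am').
have := congr1 (fun f => f (if d then I' y else y)) eqw.
by rewrite -dd /word /=; case: (d) => //=; rewrite IE I'K.
Qed.

End Word.
End PlaneModel.

(** * The automorphism group *)

Lemma roots_of_unity (k : closedFieldType) N : (0 < N)%N -> N%:R != 0 :> k ->
  exists rs : seq k, [/\ uniq rs, size rs = N & forall a, (a \in rs) = (a ^+ N == 1)].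
Proof.
move=> N0 nzN; have [rs rsE] := closed_field_poly_normal ('X^N - 1 : {poly k}).
have mon : 'X^N - 1 \is @monic k by rewrite -polyC1 monicXnsubC.
rewrite (monicP mon) scale1r in rsE; exists rs; split.
- rewrite -separable_prod_XsubC -rsE.
  have -> : 'X^N - 1 = 1 *: 'X^N + (-1)%:P :> {poly k} by rewrite scale1r polyCN.
  by apply: separable_binomial; rewrite ?oppr_eq0 ?oner_neq0.
- have := congr1 (fun p : {poly k} => size p) rsE.
  by rewrite /= size_prod_XsubC -polyC1 size_XnsubC // => -[].
- move=> a; rewrite -root_prod_XsubC -rsE rootE !hornerE.
  by rewrite subr_eq0.
Qed.

(** Translation by [1] permutes [F], so it does not change the sum of all elements. *)
Lemma natr_card_eq0 (F : finFieldType) : #|F|%:R = 0 :> F.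
Proof.
have : \sum_(a : F) (a + 1) = \sum_(a : F) a.
  by rewrite [RHS](reindex_inj (addIr 1)).
rewrite big_split /= sumr_const => /eqP.
by rewrite addrC -subr_eq0 addrK => /eqP.
Qed.

(** This excludes [i = 3], where [n = 4] leaves only three regular differentials
    [z ^ j dz / V], too few for an orbit of four elements. *)
Lemma prime_power_neq15 p h : prime p -> (p ^ h != 15)%N.
Proof.
move=> pp; apply/eqP => ph; case: h ph => // h ph.
by have := @primesX p h.+1 isT; rewrite ph (primes_prime pp).
Qed.

Local Open Scope classical_set_scope.
Local Open Scope card_scope.

Theorem theorem1p1 (p h q m i : nat)
  (p_prime : prime p) (p_odd : odd p) (q_def : q = (p ^ h)%N) (q_gt7 : (7 < q)%N)
  (m_def : (2 * m = q + 1)%N) (i_def : (2 * i = m - 2)%N)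
  (coprime_i : coprime i m) (coprime_i2 : coprime (i + 2) m)
  (F : finFieldType) (card_F : #|F| = (q ^ 2)%N)
  (k : closedFieldType) (iota : {rmorphism F -> k})
  (k_closure : is_algebraic_closure iota)
  (K : fieldType) (kappa : {rmorphism k -> K}) (x y : K)
  (K_def : is_function_field kappa m i x y) :
  fieldAut kappa = H_BMNQ kappa m i x y /\ fieldAut kappa #= `I_(4 * (q + 1))%N.
Proof.
have mE : m = (i.+1).*2 by lia.
have qE : q = (4 * i + 3)%N by lia.
have odd_i : odd i.
  apply: contraT; rewrite -dvdn2 => i_even.
  have: (2 %| gcdn i m)%N by rewrite dvdn_gcd i_even mE -muln2 dvdn_mull.
  by rewrite (eqP coprime_i).
have i_ge5 : (4 < i)%N.
  have := @prime_power_neq15 p h p_prime; rewrite -q_def qE.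
  by case: (i) odd_i q_gt7 qE => [|[|[|[|[|j]]]]] // _; rewrite ?qE //; lia.
have pk : p%:R = 0 :> k.
  have : #|F|%:R = 0 :> k by rewrite -(rmorph_nat iota) natr_card_eq0 rmorph0.
  by rewrite card_F q_def !natrX => /eqP; rewrite !expf_eq0 => /andP[_ /andP[_ /eqP]].
have qk : q%:R = 0 :> k.
  rewrite q_def natrX pk expr0n; case: h q_def => // q1.
  by rewrite q1 in q_gt7.
have nz2 : 2 != 0 :> k.
  apply: contra_eqN pk => /eqP two0.
  by rewrite -(odd_double_half p) p_odd natrD -mul2n natrM two0 mul0r addr0 oner_neq0.
have nzn : i.+1%:R != 0 :> k.
  have : (4 * i.+1)%:R = 1 :> k by rewrite (_ : 4 * i.+1 = q + 1)%N ?natrD ?qk ?add0r //; lia.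
  by rewrite natrM; apply: contra_eqN => /eqP->; rewrite mulr0 eq_sym oner_neq0.
rewrite {}mE in K_def coprime_i coprime_i2 m_def i_def *.
set m' := (i.+1).*2 in K_def *.
have [rot [rot_aut rotP]] := rotation_exists odd_i i_ge5 nz2 nzn K_def.
have [inv [inv_aut inv_x inv_y]] := inversion_exists odd_i i_ge5 nz2 nzn K_def.
have /choice[sc scP] : forall a, exists f, a ^+ (2 * m') = 1 ->
    [/\ fieldAut kappa f, f x = kappa (a ^+ m') * x & f y = kappa a * y].
  move=> a; have [am|nam] := pselect (a ^+ (2 * m') = 1); last by exists id.
  by have [f] := scale_exists odd_i i_ge5 nz2 nzn K_def am; exists f.
have scA a (am : a ^+ (2 * m') = 1) : fieldAut kappa (sc a) by have [] := scP a am.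
have scX a (am : a ^+ (2 * m') = 1) : sc a x = kappa (a ^+ m') * x by have [] := scP a am.
have scY a (am : a ^+ (2 * m') = 1) : sc a y = kappa a * y by have [] := scP a am.
have complete := word_complete odd_i i_ge5 nz2 nzn K_def rot_aut rotP
  inv_aut inv_x inv_y scA scX scY.
have inj := word_inj odd_i i_ge5 nz2 nzn K_def rot_aut rotP
  inv_aut inv_x inv_y scA scX scY.
split.
  rewrite eqEsubset; split=> [f /complete[e [a [d [am ->]]]] G [G_sub G_gen]|].
    exact: (word_mem rot_aut rotP inv_aut inv_x inv_y scA scX scY G_sub G_gen).
  apply: smallest_sub; first exact: fieldAut_subgroup.
  by move=> f [].
have N_gt0 : (0 < 2 * m')%N by [].
have nzN : (2 * m')%:R != 0 :> k by rewrite natrM /m' -muln2 natrM !mulf_neq0.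
have [rs [rs_uniq rs_size rsP]] := roots_of_unity N_gt0 nzN.
have rs_unity (j : 'I_(2 * m')) : (rs`_j) ^+ (2 * m') = 1.
  by apply/eqP; rewrite -rsP mem_nth ?rs_size.
pose T : finType := (bool * 'I_(2 * m') * bool)%type.
have cardT : #|T| = (4 * (q + 1))%N.
  by rewrite !card_prod card_bool card_ord -m_def; lia.
rewrite -cardT (card_eqr card_II).
pose g (j : 'I_#|T|) := let u := enum_val j in word rot inv sc u.1.1 rs`_u.1.2 u.2.
have g_inj : injective g.
  move=> j j' /inj[] // e_eq a_eq d_eq; apply: enum_val_inj.
  move: e_eq a_eq d_eq; case: (enum_val j) => -[e a] d; case: (enum_val j') => -[e' a'] d' /=.
  move=> -> /eqP + ->; rewrite nth_uniq ?rs_size // => /eqP/val_inj->.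
  by [].
have -> : fieldAut kappa = g @` [set: 'I_#|T|].
  rewrite eqEsubset; split=> [f /complete[e [a [d [am ->]]]]|_ [j _ <-]]; last first.
    exact: (word_aut rot_aut rotP inv_aut inv_x inv_y scA scX scY).
  have a_rs : a \in rs by rewrite rsP am.
  have lt_j : (index a rs < 2 * m')%N by rewrite -rs_size index_mem.
  exists (enum_rank ((e, Ordinal lt_j, d) : T)) => //.
  by rewrite /g enum_rankK /= nth_index.
by apply: inj_card_eq => j j' _ _; apply: g_inj.
Qed.
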